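(* Let $\mathcal{C}^\bullet$ be a differential graded algebra over $\mathbb{F}_2$ whose cohomology algebra $H^\bullet$ is isomorphic, as a graded $\mathbb{F}_2$-algebra, to $\mathbb{F}_2[a,b,c]/(ab,bc)$, where $a,b,c$ are in degree one. Then $\mathcal{C}^\bullet$ is $A_3$-formal. Thus, all triple Massey products for $\mathcal{C}^\bullet$ vanish: for all $x,y,z\in H^\bullet$ with $x\cup y=0$ and $y\cup z=0$, the triple Massey product $\langle x,y,z\rangle$ vanishes. In particular, the triple Massey product $\langle a,b,c\rangle$ (of the classes in $H^\bullet$ corresponding to $a,b,c$) vanishes for $\mathcal{C}^\bullet$.
   Context: All algebras and vector spaces are over $\mathbb{F}_2$. A differential graded algebra (DGA) $(\mathcal{C}^\bullet,\delta,\cup)$ has a differential $\delta$ raising degree by one; $H^\bullet$ denotes its cohomology algebra with induced product $\cup$. **Triple Massey products.** Let $x,y,z\in H^\bullet$ with $x\cup y=0$ and $y\cup z=0$. A defining system $M=\{X,Y,Z,E_{xy},E_{yz}\}$ consists of cocycles $X,Y,Z$ representing $x,y,z$, respectively, and cochains $E_{xy},E_{yz}$ with $\delta E_{xy}=X\cup Y$ and $\delta E_{yz}=Y\cup Z$. The cochain $X\cup E_{yz}+E_{xy}\cup Z$ is a cocycle; its cohomology class is denoted $\langle x,y,z\rangle_M\in H^\bullet$. The triple Massey product $\langle x,y,z\rangle$ is the set of all classes $\langle x,y,z\rangle_M$ for all defining systems $M$. The image of $\langle x,y,z\rangle_M$ in $H^\bullet/(x\cup H^\bullet+H^\bullet\cup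 z)$ does not depend on $M$. One says that $\langle x,y,z\rangle$ vanishes if this image is zero. **$A_3$-formality.** An $A_\infty$-algebra over $\mathbb{F}_2$ is a graded vector space $E$ with graded linear maps $m_n\colon E^{\otimes n}\to E$ of degree $2-n$ ($n\ge 1$) such that $\sum_{r+s+t=n} m_{r+1+t}(1^{\otimes r}\otimes m_s\otimes 1^{\otimes t})=0$ for all $n\ge 1$ (with $s\ge1$, $r,t\ge 0$). A DGA is an $A_\infty$-algebra with $m_1=\delta$, $m_2=\cup$, $m_n=0$ for $n\ge 3$. A morphism of $A_\infty$-algebras $E\to E'$ is a family of linear maps $f_n\colon E^{\otimes n}\to E'$ of degree $1-n$ with $\sum_{r+s+t=n} f_{r+1+t}(1^{\otimes r}\otimes m_s\otimes 1^{\otimes t})=\sum_{i_1+\cdots+i_q=n} m'_q(f_{i_1}\otimes\cdots\otimes f_{i_q})$ for all $n\geq 1$; it is a quasi-isomorphism if $f_1$ is a quasi-isomorphism of complexes. A minimal model of $\mathcal{C}^\bullet$ is an $A_\infty$-structure $\{m_n\}_{n\ge1}$ on $H^\bullet$ with $m_1=0$ together with a quasi-isomorphism of $A_\infty$-algebras $(H^\bullet,\{m_n\})\to(\mathcal{C}^\bullet,\delta,\cup)$ (it exists, and any two are isomorphic as $A_\infty$-algebras). $\mathcal{C}^\bullet$ is called $A_3$-formal if its minimal model can be chosen such that $m_3=0$. *)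

(* Defs.v *)
From HB Require Import structures.
From mathcomp Require Import all_boot all_order all_algebra.
From mathcomp Require Import generic_quotient ring_quotient boolp.
From mathcomp Require Import mpoly.

Set Implicit Arguments.
Unset Strict Implicit.
Unset Printing Implicit Defensive.

Import GRing.Theory.
Local Open Scope ring_scope.
Local Open Scope quotient_scope.

(* Graded vector spaces are internally Z-graded: the direct sum decomposition
   is given by the projections [gproj i] onto the summands. *)
HB.mixin Record isGraded V of GRing.Lmodule 'F_2 V := {
  gproj : int -> V -> V;
  gproj_linear : forall i, linear (gproj i);
  gprojK : forall i j v, gproj i (gproj j v) = if i == j then gproj j v else 0;
  gproj_sum : forall v, exists2 s : seq int, uniq s & v = \sum_(i <- s) gproj i v
}.
#[short(type="grVectType")]
HB.structure Definition GrVect := {V of GRing.Lmodule 'F_2 V & isGraded V}.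

HB.instance Definition _ (V : grVectType) (i : int) :=
  GRing.isLinear.Build 'F_2 V V _ (@gproj V i) (gproj_linear i).

Definition homogeneous (V : grVectType) (i : int) : {pred V} :=
  [pred v | gproj i v == v].

(* MathComp algebras are nonzero, so the zero DGA is excluded; its cohomology
   is zero.  Since the cohomology of a nonzero DGA may vanish, cohomology
   carries separate [pzRingType] and [grVectType] structures instead. *)
HB.mixin Record isGradedAlgebra A of GRing.Algebra 'F_2 A & GrVect A := {
  homogeneous1 : (1 : A) \in homogeneous 0;
  homogeneousM : forall i j (x y : A),
    x \in homogeneous i -> y \in homogeneous j -> x * y \in homogeneous (i + j)
}.
#[short(type="grAlgType")]
HB.structure Definition GrAlg :=
  {A of GRing.Algebra 'F_2 A & GrVect A & isGradedAlgebra A}.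

HB.mixin Record isComplex V of GrVect V := {
  diff : V -> V;
  diff_linear : linear diff;
  diff_homogeneous : forall i v, v \in homogeneous i -> diff v \in homogeneous (i + 1);
  diff_diff : forall v, diff (diff v) = 0
}.
#[short(type="complexType")]
HB.structure Definition Complex := {V of GrVect V & isComplex V}.

HB.instance Definition _ (V : complexType) :=
  GRing.isLinear.Build 'F_2 V V _ (@diff V) diff_linear.

(* No signs: the characteristic is 2. *)
HB.mixin Record isDGA C of GrAlg C & Complex C := {
  leibniz : forall x y : C, diff (x * y) = diff x * y + x * diff y
}.
#[short(type="dgaType")]
HB.structure Definition DGA := {C of GrAlg C & Complex C & isDGA C}.

Lemma F2_addvv (V : lmodType 'F_2) (v : V) : v + v = 0.
Proof.
rewrite -[v]scale1r -scalerDl.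
have -> : (1 + 1 : 'F_2) = 0 by apply/val_inj.
by rewrite scale0r.
Qed.

Section GradedTheory.
Variable V : grVectType.

Lemma homogeneousP i (v : V) : reflect (gproj i v = v) (v \in homogeneous i).
Proof. exact: eqP. Qed.

Lemma homogeneous_gproj i (v : V) : gproj i v \in homogeneous i.
Proof. by apply/homogeneousP; rewrite gprojK eqxx. Qed.

Lemma homogeneous0 i : (0 : V) \in homogeneous i.
Proof. by apply/homogeneousP; rewrite raddf0. Qed.

Lemma homogeneousD i : {in homogeneous i &, forall u v : V, u + v \in homogeneous i}.
Proof.
by move=> u v /homogeneousP hu /homogeneousP hv; apply/homogeneousP; rewrite raddfD /= hu hv.
Qed.

Lemma gproj_notin (v : V) s i :
  v = \sum_(j <- s) gproj j v -> i \notin s -> gproj i v = 0.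
Proof.
move=> e nis; rewrite e raddf_sum big_seq big1 // => j js /=.
by rewrite gprojK; case: eqP => // ij; rewrite ij js in nis.
Qed.

End GradedTheory.

Lemma shift_gproj (V W : grVectType) (f : {linear V -> W}) (k : int) :
  (forall i v, v \in homogeneous i -> f v \in homogeneous (i + k)) ->
  forall i v, gproj (i + k) (f v) = f (gproj i v).
Proof.
move=> hf i v; have [s us e] := gproj_sum v.
have {2}-> : v = \sum_(j <- s) gproj j v by [].
rewrite {1}e !raddf_sum /=; apply: eq_bigr => j _.
have /homogeneousP ej := hf _ _ (homogeneous_gproj j v).
rewrite -[in LHS]ej !gprojK (inj_eq (addIr k)) ej.
by case: (i == j); rewrite // raddf0.
Qed.

Section Cocycles.
Variable V : complexType.

Definition cocycle_pred : {pred V} := [pred v | diff v == 0].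

Lemma cocycle_submod : submod_closed cocycle_pred.
Proof.
split=> [|a u v]; rewrite !inE ?raddf0 // => /eqP hu /eqP hv.
by rewrite linearP /= hu hv scaler0 addr0.
Qed.
HB.instance Definition _ :=
  GRing.isSubmodClosed.Build 'F_2 V cocycle_pred cocycle_submod.

Record cocycle := Cocycle {cocycle_val :> V; cocycleP : cocycle_val \in cocycle_pred}.
HB.instance Definition _ := [isSub for cocycle_val].
HB.instance Definition _ := [Choice of cocycle by <:].
HB.instance Definition _ := [SubChoice_isSubLmodule of cocycle by <:].

Fact cocycle_val_linear : linear cocycle_val.
Proof. by []. Qed.
HB.instance Definition _ :=
  GRing.isLinear.Build 'F_2 cocycle V _ cocycle_val cocycle_val_linear.

Lemma diff_cocycle (z : cocycle) : diff (z : V) = 0.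
Proof. exact/eqP/(cocycleP z). Qed.

Definition coboundary : {pred cocycle} :=
  [pred z : cocycle | `[< exists w : V, z = diff w :> V >]].

Lemma coboundaryP (z : cocycle) :
  reflect (exists w : V, z = diff w :> V) (z \in coboundary).
Proof. exact: asboolP. Qed.

Lemma coboundary_submod : submod_closed coboundary.
Proof.
split=> [|a u v]; first by apply/coboundaryP; exists 0; rewrite !raddf0.
move=> /coboundaryP[x ex] /coboundaryP[y ey]; apply/coboundaryP.
by exists (a *: x + y); rewrite !linearP /= ex ey.
Qed.
HB.instance Definition _ :=
  GRing.isSubmodClosed.Build 'F_2 cocycle coboundary coboundary_submod.

Definition cohomology := Quotient.quot coboundary.
HB.instance Definition _ := GRing.Zmodule.on cohomology.
HB.instance Definition _ := EqQuotient.on cohomology.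

Definition class (z : cocycle) : cohomology := \pi_cohomology z.

Lemma eq_class (y z : cocycle) :
  class y = class z <-> exists w : V, cocycle_val y - cocycle_val z = diff w.
Proof.
rewrite /class; split=> [/eqP|h].
  by rewrite -Quotient.idealrBE => /coboundaryP[w]; rewrite raddfB; exists w.
apply/eqP; rewrite -Quotient.idealrBE; apply/coboundaryP.
by case: h => w hw; exists w; rewrite raddfB.
Qed.

Lemma class_repr (x : cohomology) : class (repr x) = x.
Proof. exact: reprK. Qed.

Lemma class_is_zmod : zmod_morphism class.
Proof. by move=> x y; rewrite /class raddfB. Qed.
HB.instance Definition _ :=
  GRing.isZmodMorphism.Build cocycle cohomology class class_is_zmod.

Definition cohomology_scale (a : 'F_2) (x : cohomology) : cohomology :=
  class (a *: repr x).

Lemma cohomology_scaleE a z : cohomology_scale a (class z) = class (a *: z).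
Proof.
apply/eq_class; have /eq_class[w hw] := class_repr (class z).
by exists (a *: w); rewrite [RHS]linearZ /= -hw scalerBr !linearZ.
Qed.

Fact cohomology_scaleA a b v :
  cohomology_scale a (cohomology_scale b v) = cohomology_scale (a * b) v.
Proof. by rewrite -(class_repr v) !cohomology_scaleE scalerA. Qed.
Fact cohomology_scale1 : left_id 1 cohomology_scale.
Proof. by move=> v; rewrite -(class_repr v) cohomology_scaleE scale1r. Qed.
Fact cohomology_scaleDr : right_distributive cohomology_scale +%R.
Proof.
move=> a u v; rewrite -(class_repr u) -(class_repr v) -raddfD.
by rewrite !cohomology_scaleE -raddfD scalerDr.
Qed.
Fact cohomology_scaleDl v : {morph cohomology_scale^~ v : a b / a + b}.
Proof.
move=> a b; rewrite -(class_repr v) !cohomology_scaleE -raddfD.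
by rewrite scalerDl.
Qed.
HB.instance Definition _ := GRing.Zmodule_isLmodule.Build 'F_2 cohomology
  cohomology_scaleA cohomology_scale1 cohomology_scaleDr cohomology_scaleDl.

Lemma class_is_scalable : scalable class.
Proof. by move=> a z; rewrite -cohomology_scaleE. Qed.
HB.instance Definition _ :=
  GRing.isScalable.Build 'F_2 cocycle cohomology _ class class_is_scalable.

Lemma classZ a z : class (a *: z) = a *: class z.
Proof. exact: linearZ. Qed.

Lemma diff_gproj i (v : V) : diff (gproj i v) = gproj (i + 1) (diff v).
Proof. by rewrite (shift_gproj (f := @diff V) (@diff_homogeneous V)). Qed.

Lemma cocycle_gproj i (z : cocycle) : gproj i (z : V) \in cocycle_pred.
Proof. by rewrite inE diff_gproj diff_cocycle raddf0. Qed.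

Definition cohomology_gproj (i : int) (x : cohomology) : cohomology :=
  class (Cocycle (cocycle_gproj i (repr x))).

Lemma cohomology_gprojE i z :
  cohomology_gproj i (class z) = class (Cocycle (cocycle_gproj i z)).
Proof.
apply/eq_class; have /eq_class[w hw] := class_repr (class z).
exists (gproj (i - 1) w); rewrite diff_gproj subrK -hw.
by rewrite raddfB.
Qed.

Fact cohomology_gproj_linear i : linear (cohomology_gproj i).
Proof.
move=> a u v; rewrite -(class_repr u) -(class_repr v) -linearP.
rewrite !cohomology_gprojE -linearP; congr class; apply/val_inj.
by rewrite /= !linearP.
Qed.

Fact cohomology_gprojK i j x :
  cohomology_gproj i (cohomology_gproj j x) =
  if i == j then cohomology_gproj j x else 0.
Proof.
rewrite -(class_repr x) !cohomology_gprojE.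
case: eqP => [->|/eqP ij]; last rewrite -(raddf0 class).
  by congr class; apply/val_inj; rewrite /= gprojK eqxx.
by congr class; apply/val_inj; rewrite /= gprojK (negPf ij).
Qed.

Fact cohomology_gproj_sum x :
  exists2 s : seq int, uniq s & x = \sum_(i <- s) cohomology_gproj i x.
Proof.
rewrite -(class_repr x); have [s us e] := gproj_sum (cocycle_val (repr x)).
exists s => //; under eq_bigr do rewrite cohomology_gprojE.
rewrite -raddf_sum; congr class; apply/val_inj.
by rewrite raddf_sum.
Qed.
HB.instance Definition _ := isGraded.Build cohomology
  cohomology_gproj_linear cohomology_gprojK cohomology_gproj_sum.

End Cocycles.

Lemma dga_diff1 (C : dgaType) : diff (1 : C) = 0.
Proof.
have := leibniz (1 : C) 1; rewrite !mulr1 mul1r => /eqP.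
by rewrite -subr_eq0 opprD addrA subrr add0r oppr_eq0 => /eqP.
Qed.

Section CohomologyAlgebra.
Variable C : dgaType.

Lemma cocycle_subring : subring_closed (@cocycle_pred C).
Proof.
split; first by rewrite inE dga_diff1.
- by move=> u v hu hv; rewrite rpredB.
move=> u v; rewrite !inE leibniz => /eqP-> /eqP->.
by rewrite mul0r mulr0 addr0.
Qed.
HB.instance Definition _ :=
  GRing.isSubringClosed.Build C (@cocycle_pred C) cocycle_subring.
HB.instance Definition _ := [SubZmodule_isSubNzRing of cocycle C by <:].

Local Notation H := (cohomology C).

Lemma cocycle_valM (u v : cocycle C) :
  cocycle_val (u * v) = cocycle_val u * cocycle_val v.
Proof. by []. Qed.

Definition cup (x y : H) : H := class ((repr x : cocycle C) * (repr y : cocycle C)).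

Lemma cupE (u v : cocycle C) : cup (class u) (class v) = class (u * v).
Proof.
apply/eq_class.
have /eq_class[w hw] := class_repr (class u).
have /eq_class[t ht] := class_repr (class v).
exists (w * cocycle_val (repr (class v)) + cocycle_val u * t).
rewrite raddfD /= !leibniz !diff_cocycle mulr0 mul0r addr0 add0r -hw -ht.
by rewrite mulrBl mulrBr addrA subrK.
Qed.

Fact cupA : associative cup.
Proof.
move=> x y z; rewrite -(class_repr x) -(class_repr y) -(class_repr z).
by rewrite !cupE mulrA.
Qed.
Fact cup1x : left_id (class 1) cup.
Proof. by move=> x; rewrite -(class_repr x) cupE mul1r. Qed.
Fact cupx1 : right_id (class 1) cup.
Proof. by move=> x; rewrite -(class_repr x) cupE mulr1. Qed.
Fact cupDl : left_distributive cup +%R.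
Proof.
move=> x y z; rewrite -(class_repr x) -(class_repr y) -(class_repr z).
by rewrite -raddfD !cupE -raddfD mulrDl.
Qed.
Fact cupDr : right_distributive cup +%R.
Proof.
move=> x y z; rewrite -(class_repr x) -(class_repr y) -(class_repr z).
by rewrite -raddfD !cupE -raddfD mulrDr.
Qed.
HB.instance Definition _ :=
  GRing.Zmodule_isPzRing.Build H cupA cup1x cupx1 cupDl cupDr.

Lemma classM (u v : cocycle C) : class (u * v) = class u * class v.
Proof. by rewrite -cupE. Qed.

Fact cohomology_scalerAl (k : 'F_2) (x y : H) : k *: (x * y) = (k *: x) * y.
Proof.
rewrite -(class_repr x) -(class_repr y); move: (repr x) (repr y) => u v.
have -> : k *: class u = class (k *: u) by rewrite classZ.
rewrite -!classM; transitivity (class (k *: (u * v))); first by rewrite classZ.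
by congr class; apply/val_inj; exact: scalerAl.
Qed.
Fact cohomology_scalerAr (k : 'F_2) (x y : H) : k *: (x * y) = x * (k *: y).
Proof.
rewrite -(class_repr x) -(class_repr y); move: (repr x) (repr y) => u v.
have -> : k *: class v = class (k *: v) by rewrite classZ.
rewrite -!classM; transitivity (class (k *: (u * v))); first by rewrite classZ.
by congr class; apply/val_inj; exact: scalerAr.
Qed.
Fact cohomology_homogeneous1 : (1 : H) \in homogeneous 0.
Proof.
apply/homogeneousP; rewrite [gproj _ _]cohomology_gprojE; congr class.
by apply/val_inj; rewrite /=; apply/homogeneousP/homogeneous1.
Qed.
Lemma cohomology_homogeneousP i (x : H) :
  x \in homogeneous i -> exists2 z : cocycle C, x = class z & cocycle_val z \in homogeneous i.
Proof.
move=> /homogeneousP e; exists (Cocycle (cocycle_gproj i (repr x))).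
  by rewrite -[LHS]e.
exact: homogeneous_gproj.
Qed.
Fact cohomology_homogeneousM i j (x y : H) :
  x \in homogeneous i -> y \in homogeneous j -> x * y \in homogeneous (i + j).
Proof.
move=> /cohomology_homogeneousP[u -> hu] /cohomology_homogeneousP[v -> hv].
apply/homogeneousP; rewrite -classM [gproj _ _]cohomology_gprojE; congr class.
by apply/val_inj; rewrite /=; apply/homogeneousP/homogeneousM.
Qed.
End CohomologyAlgebra.

Record chain_map (V W : complexType) := ChainMap {
  chain_fun :> {linear V -> W};
  chain_homogeneous : forall i v, v \in homogeneous i -> chain_fun v \in homogeneous i;
  chain_diff : forall v, chain_fun (diff v) = diff (chain_fun v)
}.

Section QuasiIso.
Variables (V W : complexType) (f : chain_map V W).

Lemma chain_cocycle (z : cocycle V) : f (cocycle_val z) \in @cocycle_pred W.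
Proof. by rewrite inE -chain_diff diff_cocycle raddf0. Qed.

Definition cohomology_map (x : cohomology V) : cohomology W :=
  class (Cocycle (chain_cocycle (repr x))).

Lemma cohomology_mapE z :
  cohomology_map (class z) = class (Cocycle (chain_cocycle z)).
Proof.
apply/eq_class; have /eq_class[w hw] := class_repr (class z).
by exists (f w); rewrite -chain_diff -hw raddfB.
Qed.

Definition quasi_iso := bijective cohomology_map.

End QuasiIso.

(* A family of linear maps [E^{\otimes n} -> F], n >= 1, is encoded as one
   function on sequences, multilinear in the entries: the n-th map is the
   restriction to sequences of size n.  The value at [::] is irrelevant. *)
Definition multilinear (E F : grVectType) (f : seq E -> F) :=
  forall s1 s2 : seq E, linear (fun x => f (s1 ++ x :: s2)).

(* The n-th map has degree [k - n]. *)
Definition multigraded (k : int) (E F : grVectType) (f : seq E -> F) :=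
  forall vs : seq (int * E), (0 < size vs)%N ->
    all (fun u => u.2 \in homogeneous u.1) vs ->
    f (unzip2 vs) \in homogeneous (\sum_(u <- vs) u.1 + (k - (size vs)%:Z)).

(* The term f_{r+1+t} (1^{\otimes r} \otimes m_s \otimes 1^{\otimes t}). *)
Definition insert_op (E F : Type) (f : seq E -> F) (m : seq E -> E) (r s : nat)
    (v : seq E) : F :=
  f (take r v ++ m (take s (drop r v)) :: drop (r + s) v).

Definition insert_sum (E F : grVectType) (f : seq E -> F) (m : seq E -> E)
    (v : seq E) : F :=
  \sum_(0 <= r < size v) \sum_(1 <= s < (size v - r).+1) insert_op f m r s v.

Record ainf_structure (E : grVectType) := AInfStructure {
  ainf_op :> seq E -> E;
  ainf_multilinear : multilinear ainf_op;
  ainf_degree : multigraded 2 ainf_op;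
  ainf_stasheff : forall v, (0 < size v)%N -> insert_sum ainf_op ainf_op v = 0
}.

(* The sum over q and i_1 + ... + i_q = n, with all i_j >= 1, of
   m_q (f_{i_1} \otimes ... \otimes f_{i_q}). *)
Definition split_sum (E F : grVectType) (m : seq F -> F) (f : seq E -> F)
    (v : seq E) : F :=
  \sum_(1 <= q < (size v).+1)
    \sum_(i : q.-tuple 'I_(size v).+1 |
            all (leq 1) (map val i) && (sumn (map val i) == size v))
      m (map f (reshape (map val i) v)).

Record ainf_morphism (E F : grVectType) (mE : ainf_structure E)
    (mF : ainf_structure F) := AInfMorphism {
  ainf_fun :> seq E -> F;
  ainf_fun_multilinear : multilinear ainf_fun;
  ainf_fun_degree : multigraded 1 ainf_fun;
  ainf_fun_comm : forall v, (0 < size v)%N ->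
    insert_sum ainf_fun mE v = split_sum mF ainf_fun v
}.

(* The underlying complex (E, m_1). *)
Definition ainf_complex (E : grVectType) (m : ainf_structure E) : Type := E.
HB.instance Definition _ (E : grVectType) (m : ainf_structure E) :=
  GrVect.on (ainf_complex m).

Section AInfComplex.
Variables (E : grVectType) (m : ainf_structure E).

Lemma insert_sum1 (F : grVectType) (f : seq E -> F) (x : E) :
  insert_sum f m [:: x] = f [:: m [:: x]].
Proof. by rewrite /insert_sum big_nat1 subn0 big_nat1. Qed.


Definition ainf_diff (x : ainf_complex m) : ainf_complex m := m [:: x].

Fact ainf_diff_linear : linear ainf_diff.
Proof. exact: (ainf_multilinear m [::] [::]). Qed.
Fact ainf_diff_homogeneous i v :
  v \in homogeneous i -> ainf_diff v \in homogeneous (i + 1).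
Proof.
move=> hv; have := ainf_degree m (vs := [:: (i, v)]) isT.
by rewrite /= andbT big_seq1 /= => /(_ hv).
Qed.
Fact ainf_diff_diff v : ainf_diff (ainf_diff v) = 0.
Proof. by have := ainf_stasheff m (v := [:: v]) isT; rewrite insert_sum1. Qed.
HB.instance Definition _ := isComplex.Build (ainf_complex m)
  ainf_diff_linear ainf_diff_homogeneous ainf_diff_diff.

End AInfComplex.

Section AInfChainMap.
Variables (E F : grVectType) (mE : ainf_structure E) (mF : ainf_structure F).
Variable f : ainf_morphism mE mF.

Lemma split_sum1 (x : E) : split_sum mF f [:: x] = mF [:: f [:: x]].
Proof.
rewrite /split_sum /= big_nat1 (bigD1 [tuple of [:: ord_max]]) //=.
rewrite big1 ?addr0 // => i /andP[/andP[]].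
case/tupleP: i => a t; rewrite tuple0 /= addn0 => _ /eqP e /negP[].
by apply/eqP/val_inj => /=; congr [:: _]; apply/val_inj.
Qed.

Definition ainf_fun1 (x : ainf_complex mE) : ainf_complex mF := f [:: x].

Fact ainf_fun1_linear : linear ainf_fun1.
Proof. exact: (ainf_fun_multilinear f [::] [::]). Qed.
HB.instance Definition _ := GRing.isLinear.Build 'F_2
  (ainf_complex mE) (ainf_complex mF) _ ainf_fun1 ainf_fun1_linear.

Fact ainf_fun1_homogeneous i v :
  v \in homogeneous i -> ainf_fun1 v \in homogeneous i.
Proof.
move=> hv; have := ainf_fun_degree f (vs := [:: (i, v)]) isT.
by rewrite /= andbT big_seq1 /= subrr addr0 => /(_ hv).
Qed.
Fact ainf_fun1_diff v : ainf_fun1 (diff v) = diff (ainf_fun1 v).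
Proof.
have := ainf_fun_comm f (v := [:: v]) isT.
by rewrite insert_sum1 split_sum1.
Qed.

Definition ainf_chain_map : chain_map (ainf_complex mE) (ainf_complex mF) :=
  @ChainMap (ainf_complex mE) (ainf_complex mF) ainf_fun1
    ainf_fun1_homogeneous ainf_fun1_diff.

Definition ainf_quasi_iso := quasi_iso ainf_chain_map.

End AInfChainMap.

Section DGAasAInf.
Variable C : dgaType.

Definition dga_op (v : seq C) : C :=
  match v with
  | [:: x] => diff x
  | [:: x; y] => x * y
  | _ => 0
  end.

Fact dga_multilinear : multilinear dga_op.
Proof.
move=> [|a [|b s1]] [|c s2] k x y /=.
- by rewrite linearP.
- by case: s2 => [|d s2] /=; rewrite ?scaler0 ?addr0 // mulrDl scalerAl.
- by rewrite mulrDr scalerAr.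
- by rewrite scaler0 addr0.
- by case: s1 => [|d s1] /=; rewrite scaler0 addr0.
- by case: s1 => [|d s1] /=; rewrite scaler0 addr0.
Qed.

Fact dga_degree : multigraded 2 dga_op.
Proof.
move=> [|[i x] [|[j y] [|[k z] vs]]] //= _.
- by rewrite andbT big_seq1 /= => /diff_homogeneous.
- rewrite andbT => /andP[hx hy]; rewrite !big_cons big_nil /= addr0.
  by rewrite !addr0 homogeneousM.
- by rewrite homogeneous0.
Qed.


Lemma dga_op_gt2 (v : seq C) : (2 < size v)%N -> dga_op v = 0.
Proof. by case: v => [|a [|b [|c v]]]. Qed.

Fact dga_stasheff v : (0 < size v)%N -> insert_sum dga_op dga_op v = 0.
Proof.
case: v => [|x [|y [|z [|t v]]]] // _.
- by rewrite /insert_sum !big_nat1 /insert_op /= diff_diff.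
- rewrite /insert_sum big_ltn // big_nat1 big_ltn // !big_nat1 /insert_op /=.
  by rewrite leibniz addrA F2_addvv add0r F2_addvv.
- rewrite /insert_sum 2?big_ltn // big_nat1 2?big_ltn // !big_nat1.
  rewrite big_ltn // !big_nat1 /insert_op /= mulrA.
  by rewrite (raddf0 (@diff C)) !(add0r, addr0) F2_addvv.
set w := [:: x, y, z, t & v].
apply: big1_seq => r /=; rewrite mem_index_iota => /andP[_ /ltnW hr].
apply: big1_seq => s /=; rewrite mem_index_iota => /andP[_]; rewrite ltnS => hs.
have [s_gt2|s_le2] := ltnP 2 s.
  rewrite /insert_op (dga_op_gt2 (v := take _ _)) ?size_takel ?size_drop //.
  have := dga_multilinear (take r w) (drop (r + s) w) 1 0 0.
  by rewrite /= !scale1r addr0 F2_addvv.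
rewrite /insert_op dga_op_gt2 // size_cat /= size_drop size_takel //.
rewrite addnS ltnS subnDA addnBA // subnKC //.
exact: (@leq_sub 4 _ 2).
Qed.

Definition dga_ainf : ainf_structure C :=
  AInfStructure dga_multilinear dga_degree dga_stasheff.

End DGAasAInf.

Record minimal_model (C : dgaType) := MinimalModel {
  model_op :> ainf_structure (cohomology C);
  model_op1 : forall x, model_op [:: x] = 0;
  model_map : ainf_morphism model_op (dga_ainf C);
  model_quasi_iso : ainf_quasi_iso model_map
}.

Definition A3_formal (C : dgaType) : Prop :=
  exists M : minimal_model C, forall x y z, M [:: x; y; z] = 0.

Section Massey.
Variable C : dgaType.
Local Notation H := (cohomology C).

Record defining_system (x y z : H) := DefiningSystem {
  ds_X : cocycle C; ds_Y : cocycle C; ds_Z : cocycle C;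
  ds_Exy : C; ds_Eyz : C;
  ds_classX : class ds_X = x;
  ds_classY : class ds_Y = y;
  ds_classZ : class ds_Z = z;
  ds_diffxy : diff ds_Exy = cocycle_val ds_X * cocycle_val ds_Y;
  ds_diffyz : diff ds_Eyz = cocycle_val ds_Y * cocycle_val ds_Z
}.

Section Product.
Variables (x y z : H) (M : defining_system x y z).

Fact massey_cocycle :
  cocycle_val (ds_X M) * ds_Eyz M + ds_Exy M * cocycle_val (ds_Z M)
    \in @cocycle_pred C.
Proof.
rewrite inE raddfD /= !leibniz !diff_cocycle ds_diffxy ds_diffyz.
by rewrite mul0r mulr0 add0r addr0 mulrA F2_addvv.
Qed.

Definition massey_class : H := class (Cocycle massey_cocycle).

End Product.

Definition massey_product (x y z w : H) : Prop :=
  exists M : defining_system x y z, w = massey_class M.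

Definition massey_indeterminacy (x z w : H) : Prop :=
  exists u v : H, w = x * u + v * z.

(* The image of the Massey product in the quotient by the indeterminacy
   is {0}; in particular the Massey product is defined. *)
Definition massey_vanishes (x y z : H) : Prop :=
  (exists w, massey_product x y z w) /\
  (forall w, massey_product x y z w -> massey_indeterminacy x z w).

End Massey.

Section PolynomialQuotient.
Local Notation P := {mpoly 'F_2[3]}.
Local Notation Xa := ('X_(inord 0) : P).
Local Notation Xb := ('X_(inord 1) : P).
Local Notation Xc := ('X_(inord 2) : P).

Definition abc_ideal : {pred P} :=
  [pred p : P | `[< exists q r : P, p = q * (Xa * Xb) + r * (Xb * Xc) >]].

Lemma abc_idealP (p : P) :
  reflect (exists q r : P, p = q * (Xa * Xb) + r * (Xb * Xc)) (p \in abc_ideal).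
Proof. exact: asboolP. Qed.

Fact abc_idealr_closed : idealr_closed abc_ideal.
Proof.
split.
- by apply/abc_idealP; exists 0, 0; rewrite !mul0r addr0.
- apply/negP => /abc_idealP[q [r /(congr1 (meval (fun=> 0)))]].
  rewrite mevalD !mevalM !mevalXU !(mul0r, mulr0) addr0 meval1.
  by move/eqP; rewrite oner_eq0.
- move=> a u v /abc_idealP[q [r ->]] /abc_idealP[q' [r' ->]]; apply/abc_idealP.
  exists (a * q + q'), (a * r + r').
  by rewrite mulrDr !mulrDl !mulrA addrACA.
Qed.
HB.instance Definition _ := isIdealr.Build P abc_ideal abc_idealr_closed.

Definition F2abc := {ideal_quot abc_ideal}.
HB.instance Definition _ := GRing.ComNzRing.on F2abc.
HB.instance Definition _ := EqQuotient.on F2abc.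

Definition abc_pi (p : P) : F2abc := \pi_F2abc p.

Definition abc_a : F2abc := abc_pi Xa.
Definition abc_b : F2abc := abc_pi Xb.
Definition abc_c : F2abc := abc_pi Xc.

Lemma eq_abc_pi (p q : P) : abc_pi p = abc_pi q <-> p - q \in abc_ideal.
Proof.
rewrite /abc_pi; split=> [/eqP|h]; first by rewrite -Quotient.idealrBE.
by apply/eqP; rewrite -Quotient.idealrBE.
Qed.

Lemma abc_pi_repr (x : F2abc) : abc_pi (repr x) = x.
Proof. exact: reprK. Qed.

Fact abc_pi_zmod : zmod_morphism abc_pi.
Proof. by move=> p q; rewrite /abc_pi raddfB. Qed.
HB.instance Definition _ := GRing.isZmodMorphism.Build P F2abc abc_pi abc_pi_zmod.
Fact abc_pi_monoid : monoid_morphism abc_pi.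
Proof. by split=> [|p q]; rewrite /abc_pi ?rmorph1 ?rmorphM. Qed.
HB.instance Definition _ :=
  GRing.isMonoidMorphism.Build P F2abc abc_pi abc_pi_monoid.

Definition abc_scale (k : 'F_2) (x : F2abc) : F2abc := abc_pi k%:MP * x.
Fact abc_scaleA k l x : abc_scale k (abc_scale l x) = abc_scale (k * l) x.
Proof. by rewrite /abc_scale mulrA -rmorphM -mpolyCM. Qed.
Fact abc_scale1 : left_id 1 abc_scale.
Proof. by move=> x; rewrite /abc_scale rmorph1 mul1r. Qed.
Fact abc_scaleDr : right_distributive abc_scale +%R.
Proof. by move=> k x y; rewrite /abc_scale mulrDr. Qed.
Fact abc_scaleDl x : {morph abc_scale^~ x : k l / k + l}.
Proof. by move=> k l; rewrite /abc_scale mpolyCD raddfD mulrDl. Qed.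
HB.instance Definition _ := GRing.Zmodule_isLmodule.Build 'F_2 F2abc
  abc_scaleA abc_scale1 abc_scaleDr abc_scaleDl.
Fact abc_scaleAl (k : 'F_2) (x y : F2abc) : k *: (x * y) = k *: x * y.
Proof. exact: mulrA. Qed.
HB.instance Definition _ := GRing.Lmodule_isLalgebra.Build 'F_2 F2abc abc_scaleAl.
Fact abc_scaleAr (k : 'F_2) (x y : F2abc) : k *: (x * y) = x * (k *: y).
Proof. exact: mulrCA. Qed.
HB.instance Definition _ := GRing.Lalgebra_isAlgebra.Build 'F_2 F2abc abc_scaleAr.

Fact abc_pi_scalable : scalable abc_pi.
Proof. by move=> k p; rewrite -mul_mpolyC rmorphM. Qed.
HB.instance Definition _ :=
  GRing.isScalable.Build 'F_2 P F2abc _ abc_pi abc_pi_scalable.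

(* [pihomog mdeg d] extracts the part of total degree d. *)
Definition mpoly_gproj (i : int) (p : P) : P :=
  if i is Posz d then pihomog mdeg d p else 0.

Fact mpoly_gproj_linear i : linear (mpoly_gproj i).
Proof.
by case: i => d a p q /=; rewrite ?linearP // scaler0 addr0.
Qed.
HB.instance Definition _ i :=
  GRing.isLinear.Build 'F_2 P P _ (mpoly_gproj i) (mpoly_gproj_linear i).

Fact mpoly_gprojK i j p :
  mpoly_gproj i (mpoly_gproj j p) = if i == j then mpoly_gproj j p else 0.
Proof.
case: i j => d [e|e] /=; rewrite ?raddf0 ?if_same //.
have [[->]|/eqP de] := @eqP _ (Posz d) (Posz e).
  exact: pihomog_id.
by apply: (@pihomog_ne0 _ _ _ e); [rewrite eq_sym | exact: pihomogP].
Qed.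

Lemma mpoly_gproj_homog i d p : p \is d.-homog ->
  mpoly_gproj i p = if i == Posz d then p else 0.
Proof.
move=> hp; have [->|ne] := @eqP _ i (Posz d); first exact: pihomog_dE.
case: i ne => //= e ne; apply: pihomog_ne0 hp.
by apply/eqP => de; rewrite de in ne.
Qed.

Lemma mpoly_gprojM2 i (p m : P) : m \is 2.-homog ->
  mpoly_gproj i (p * m) = mpoly_gproj (i - 2) p * m.
Proof.
move=> hm; rewrite (@pihomog_partitionE _ _ mdeg _ p (leqnn _)).
rewrite mulr_suml !raddf_sum mulr_suml; apply: eq_bigr => d _.
have hd := pihomogP mdeg d p.
rewrite /= (mpoly_gproj_homog _ hd) (mpoly_gproj_homog _ (dhomogM hd hm)).
by rewrite PoszD subr_eq; case: ifP; rewrite ?mul0r.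
Qed.

Lemma abc_ideal_gproj i p : p \in abc_ideal -> mpoly_gproj i p \in abc_ideal.
Proof.
have hX (j k : 'I_3) : ('X_j * 'X_k : P) \is 2.-homog.
  by apply: (@dhomogM _ _ _ 1 _ 1); rewrite dhomogX /= mdeg1.
move=> /abc_idealP[q [r ->]]; apply/abc_idealP.
exists (mpoly_gproj (i - 2) q), (mpoly_gproj (i - 2) r).
by rewrite raddfD /= !mpoly_gprojM2.
Qed.

Definition abc_gproj (i : int) (x : F2abc) : F2abc :=
  abc_pi (mpoly_gproj i (repr x)).

Lemma abc_gprojE i p : abc_gproj i (abc_pi p) = abc_pi (mpoly_gproj i p).
Proof.
apply/eq_abc_pi; rewrite -raddfB; apply: abc_ideal_gproj.
by apply/eq_abc_pi; rewrite abc_pi_repr.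
Qed.

Fact abc_gproj_linear i : linear (abc_gproj i).
Proof.
move=> a u v; rewrite -(abc_pi_repr u) -(abc_pi_repr v) -linearP.
by rewrite !abc_gprojE !linearP.
Qed.
Fact abc_gprojK i j x :
  abc_gproj i (abc_gproj j x) = if i == j then abc_gproj j x else 0.
Proof.
rewrite -(abc_pi_repr x) !abc_gprojE mpoly_gprojK.
by case: eqP => // _; rewrite raddf0.
Qed.
Fact abc_gproj_sum x :
  exists2 s : seq int, uniq s & x = \sum_(i <- s) abc_gproj i x.
Proof.
rewrite -(abc_pi_repr x); set p := repr x.
exists (map Posz (iota 0 (msize p))).
  by rewrite map_inj_uniq ?iota_uniq // => ? ? [].
rewrite big_map; under eq_bigr do rewrite abc_gprojE /=.
rewrite -raddf_sum; congr abc_pi.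
have -> : iota 0 (msize p) = index_iota 0 (msize p) by rewrite /index_iota subn0.
by rewrite big_mkord -pihomog_partitionE.
Qed.
HB.instance Definition _ := isGraded.Build F2abc
  abc_gproj_linear abc_gprojK abc_gproj_sum.

Fact abc_homogeneous1 : (1 : F2abc) \in homogeneous 0.
Proof.
apply/homogeneousP; rewrite -(rmorph1 abc_pi) [gproj _ _]abc_gprojE /=.
by rewrite pihomog_dE // dhomog1.
Qed.
Lemma abc_homogeneousP i (x : F2abc) :
  x \in homogeneous i -> exists2 p : P, x = abc_pi p & mpoly_gproj i p = p.
Proof.
move=> /homogeneousP e; exists (mpoly_gproj i (repr x)).
  by rewrite -[LHS]e.
by rewrite mpoly_gprojK eqxx.
Qed.
Fact abc_homogeneousM i j (x y : F2abc) :
  x \in homogeneous i -> y \in homogeneous j -> x * y \in homogeneous (i + j).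
Proof.
move=> /abc_homogeneousP[p -> hp] /abc_homogeneousP[q -> hq].
apply/homogeneousP; rewrite -rmorphM [gproj _ _]abc_gprojE; congr abc_pi.
case: i hp => [d|d] /= hp; last by rewrite -hp mul0r raddf0.
case: j hq => [e|e] /= hq; last by rewrite -hq mulr0 raddf0.
by rewrite /= pihomog_dE // dhomogM // homog_piE ?hp ?hq.
Qed.
HB.instance Definition _ :=
  isGradedAlgebra.Build F2abc abc_homogeneous1 abc_homogeneousM.

End PolynomialQuotient.

(* A bijective linear map preserving degrees is also graded in the inverse
   direction, the homogeneous components being in direct sum. *)
Record cohomology_iso (A : grAlgType) (C : dgaType) := CohomologyIso {
  coh_iso :> {linear A -> cohomology C};
  coh_iso_monoid : monoid_morphism coh_iso;
  coh_iso_homogeneous : forall i x,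
    x \in homogeneous i -> coh_iso x \in homogeneous i;
  coh_iso_bij : bijective coh_iso
}.

(* Main.v *)
(** Write H for the cohomology.  By Kadeishvili's inductive construction, a graded
    section f1 : H -> C by cocycles together with homotopies f2 from f1 x * f1 y
    to f1 (x y) extends to a minimal model as soon as the cocycles
      f1 x * f2 y z + f2 x y * f1 z + f2 (x y) z + f2 x (y z)
    are coboundaries, and then m_3 = 0; the same f1, f2 show that the Massey
    products vanish.

    Let A, B, G be cocycles representing a, b, c, and choose null-homotopies of
    AB, BA, BG, GB and AG + GA.  On the basis a^i c^j, b^(k+1) of H, explicit f1
    and f2 are built from them, and the cocycles above are coboundaries provided
    that eight of them are: those attached to aba, cbc, abc, cba, bab, bcb,
    acb + cab and bac + bca.  The differentials of products of two null-homotopies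
    give relations between these eight classes of H^2, which show that they vanish
    simultaneously once the null-homotopies are corrected by suitable elements of
    H^1. *)

Require Import Defs.
From mathcomp Require Import all_boot all_algebra.
From mathcomp Require Import boolp ssrcomplements mpoly.
From mathcomp Require classical_sets.
From mathcomp Require Import ring.

Set Implicit Arguments.
Unset Strict Implicit.
Unset Printing Implicit Defensive.

Import GRing.Theory.
Local Open Scope ring_scope.

(** * Sums over F_2 *)

(** As an associative algebra, H is presented by the five relations ab, ba, bc, cb and ac + ca, each
    of which has one null-homotopy in C; both orders are needed because C is not commutative. With
    leading words ab, ba, bc, cb and ca, the normal words are a^i c^j and b^(k+1), and f2 records
    the rewriting of a product of two normal words. Two ways of rewriting a product of three differ,
    up to coboundaries, only at overlaps of leading words: these are aba, abc, cba, cbc, bab, bcb,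
    cab and bca, whence the number eight. The obstacle is that corrections of five null-homotopies
    have to kill eight classes at once, each correction entering several of them. The relations
    compensate: aH and bH share no monomial, so an equation a x + b y = 0 decouples; this confines
    bab and bcb to multiples of b^2, and aba, cbc and abc to polynomials in a and c. Once these five
    and the b^2 term of cab are zero, the relations leave no room for cab, cba and bca. *)

Inductive sum_expr := Sum0 | SumAtom of nat | SumAdd of sum_expr & sum_expr.

Fixpoint sum_eval (V : zmodType) (env : seq V) (t : sum_expr) : V :=
  match t with
  | Sum0 => 0
  | SumAtom i => nth 0 env i
  | SumAdd t u => sum_eval env t + sum_eval env u
  end.

Fixpoint sum_atoms (t : sum_expr) : seq nat :=
  match t with
  | Sum0 => [::]
  | SumAtom i => [:: i]
  | SumAdd t u => sum_atoms t ++ sum_atoms u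
  end.

Definition even_atoms (s : seq nat) := all (fun i => ~~ odd (count_mem i s)) s.

Lemma sum_evalE (V : zmodType) (env : seq V) t :
  sum_eval env t = \sum_(i <- sum_atoms t) env`_i.
Proof.
elim: t => [|i|t IHt u IHu] /=; rewrite ?big_nil ?big_seq1 //.
by rewrite big_cat /= -IHt -IHu.
Qed.

(** Signs do not matter over F_2, so the equation says that the sum of both sides is 0; grouping
    equal atoms turns this into a parity check. *)
Lemma sum_eval_eq (V : lmodType 'F_2) (env : seq V) t u :
  even_atoms (sum_atoms t ++ sum_atoms u) -> sum_eval env t = sum_eval env u.
Proof.
set s := _ ++ _ => /allP ev; apply/eqP; rewrite -subr_eq0.
have -> : - sum_eval env u = sum_eval env u.
  by apply/eqP; rewrite eq_sym -addr_eq0 F2_addvv.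
have -> : sum_eval env t + sum_eval env u = sum_eval env (SumAdd t u) by [].
rewrite sum_evalE /= -/s -big_undup_iterop_count big_seq big1 // => i.
rewrite mem_undup => /ev /negbTE o; rewrite Monoid.iteropE.
by rewrite iter_addr_0 -[count_mem i s]odd_double_half o add0n -addnn mulrnDr F2_addvv.
Qed.

(* Products and differentials are compared up to the canonical structures they
   are elaborated with. *)
Ltac same_atom x y :=
  first
  [ constr_eq x y
  | lazymatch x with
    | (?a * ?b)%R =>
      lazymatch y with (?c * ?d)%R => same_atom a c; same_atom b d end
    | (?a ^+ ?n)%R =>
      lazymatch y with (?c ^+ ?m)%R => same_atom a c; constr_eq n m end
    | diff ?a => lazymatch y with diff ?c => same_atom a c end
    end ].

Ltac sum_index x env :=
  lazymatch env with
  | ?y :: ?e =>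
    match constr:(Set) with
    | _ => let _ := match constr:(Set) with _ => same_atom x y end in constr:(0%N)
    | _ => let n := sum_index x e in constr:(S n)
    end
  end.

Ltac sum_env t env :=
  lazymatch t with
  | (?x + ?y)%R => let e := sum_env x env in sum_env y e
  | 0%R => env
  | _ =>
    match constr:(Set) with
    | _ => let _ := sum_index t env in env
    | _ => constr:(t :: env)
    end
  end.

Ltac sum_reify t env :=
  lazymatch t with
  | (?x + ?y)%R =>
    let u := sum_reify x env in let v := sum_reify y env in constr:(SumAdd u v)
  | 0%R => constr:(Sum0)
  | _ => let n := sum_index t env in constr:(SumAtom n)
  end.

(** Decides equality of F_2-sums up to order and cancellation in pairs. Products are atoms, so they
    have to be expanded beforehand. *)
Ltac char2 :=
  lazymatch goal with
  | |- @eq ?V ?l ?r =>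
    let e0 := constr:(@nil V) in
    let e1 := sum_env l e0 in let e := sum_env r e1 in
    let u := sum_reify l e in let v := sum_reify r e in
    refine (@sum_eval_eq _ e u v _); vm_compute; reflexivity
  end.

Lemma F2_oppv (V : lmodType 'F_2) (v : V) : - v = v.
Proof. by apply/eqP; rewrite eq_sym -addr_eq0 F2_addvv. Qed.

Lemma F2_addv_eq0 (V : lmodType 'F_2) (v w : V) : v + w = 0 -> v = w.
Proof. by move=> e; rewrite -[v]addr0 -e; char2. Qed.

Lemma F2_cases (k : 'F_2) : k = 0 \/ k = 1.
Proof. by case: k => [[|[|?]]] // ?; [left|right]; apply/val_inj. Qed.

Lemma F2_linear (V W : lmodType 'F_2) (f : V -> W) :
  (forall x y, f (x + y) = f x + f y) -> linear f.
Proof.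
move=> fD k x y; rewrite fD; congr (_ + _).
have f0 : f 0 = 0 by have /eqP := fD 0 0; rewrite addr0 eq_sym -subr_eq0 addrK => /eqP.
by case: (F2_cases k) => ->; rewrite ?scale0r ?scale1r.
Qed.

(** * Multilinear functions on words *)

Section SplitSum.
Variable E : Type.

(** The recursion on v, instead of an index with [take] and [drop], makes the rearrangements below
    plain inductions. Both factors may be empty. *)
Fixpoint ssum (V : zmodType) (G : seq E -> seq E -> V) (v : seq E) : V :=
  G [::] v + (if v is x :: v' then ssum (fun a b => G (x :: a) b) v' else 0).

Lemma eq_ssum (V : zmodType) (G G' : seq E -> seq E -> V) v :
  (forall a b, a ++ b = v -> G a b = G' a b) -> ssum G v = ssum G' v.
Proof.
elim: v G G' => [|x v IHv] G G' eG /=; rewrite (eG [::]) //.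
by congr (_ + _); apply: IHv => a b e; apply: eG; rewrite /= e.
Qed.

Lemma ssum0 (V : zmodType) (v : seq E) : ssum (fun _ _ => 0 : V) v = 0.
Proof. by elim: v => [|x v IHv] /=; rewrite ?IHv addr0. Qed.

Lemma ssum_eq0 (V : zmodType) (G : seq E -> seq E -> V) v :
  (forall a b, a ++ b = v -> G a b = 0) -> ssum G v = 0.
Proof. by move=> eG; rewrite -[RHS](ssum0 V v); apply: eq_ssum. Qed.

Lemma ssumD (V : zmodType) (G G' : seq E -> seq E -> V) v :
  ssum (fun a b => G a b + G' a b) v = ssum G v + ssum G' v.
Proof. by elim: v G G' => [|x v IHv] G G' /=; rewrite ?addr0 // IHv addrACA. Qed.

Lemma raddf_ssum (V W : zmodType) (f : V -> W) (G : seq E -> seq E -> V) v :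
  f 0 = 0 -> (forall x y, f (x + y) = f x + f y) ->
  f (ssum G v) = ssum (fun a b => f (G a b)) v.
Proof. by move=> f0 fD; elim: v G => [|x v IHv] G /=; rewrite fD ?IHv // f0. Qed.

Lemma exchange_ssum (V : zmodType) (G : seq E -> seq E -> seq E -> seq E -> V) v w :
  ssum (fun a b => ssum (fun c d => G a b c d) w) v =
  ssum (fun c d => ssum (fun a b => G a b c d) v) w.
Proof.
elim: v G => [|x v IHv] G /=; first by rewrite addr0; apply: eq_ssum => c d _; rewrite addr0.
by rewrite IHv -ssumD.
Qed.

(** Coassociativity of deconcatenation: both sides run over the cuts of v into three factors. *)
Lemma ssumA (V : zmodType) (G : seq E -> seq E -> seq E -> V) v :
  ssum (fun a w => ssum (fun b c => G a b c) w) v =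
  ssum (fun w c => ssum (fun a b => G a b c) w) v.
Proof.
elim: v G => [|x v IHv] G /=; first by [].
by rewrite (IHv (fun a b c => G (x :: a) b c)) addr0 ssumD addrA.
Qed.

Lemma ssum_cat_cons (V : zmodType) (G : seq E -> seq E -> V) a x c :
  ssum G (a ++ x :: c) = ssum (fun a1 a2 => G a1 (a2 ++ x :: c)) a +
                         ssum (fun c1 c2 => G (a ++ x :: c1) c2) c.
Proof.
elim: a G => [|y a IHa] G /=; first by rewrite addr0.
by rewrite IHa addrA.
Qed.

Lemma ssumE (V : zmodType) (G : seq E -> seq E -> V) v :
  ssum G v = \sum_(0 <= k < (size v).+1) G (take k v) (drop k v).
Proof.
elim: v G => [|x v IHv] G /=; first by rewrite big_nat1 addr0.
by rewrite big_nat_recl //= IHv.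
Qed.

End SplitSum.

Section Multilinear.
Variables (E F : grVectType).

Lemma multilinearD (f : seq E -> F) : multilinear f ->
  forall s1 s2 x y, f (s1 ++ (x + y) :: s2) = f (s1 ++ x :: s2) + f (s1 ++ y :: s2).
Proof. by move=> fl s1 s2 x y; have := fl s1 s2 1 x y; rewrite !scale1r. Qed.

Lemma multilinear0 (f : seq E -> F) : multilinear f ->
  forall s1 s2, f (s1 ++ 0 :: s2) = 0.
Proof.
move=> fl s1 s2; have := multilinearD fl s1 s2 0 0.
by rewrite addr0 F2_addvv.
Qed.

Lemma F2_multilinear (f : seq E -> F) :
  (forall s1 s2 x y, f (s1 ++ (x + y) :: s2) = f (s1 ++ x :: s2) + f (s1 ++ y :: s2)) ->
  multilinear f.
Proof. by move=> fD s1 s2; apply: F2_linear. Qed.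

End Multilinear.

Section Insertion.
Variables (E F : grVectType).

(* Unlike in [insert_sum], the factor b to which m is applied may be empty; it
   contributes nothing when m [::] = 0. *)
Definition insertion (f : seq E -> F) (m : seq E -> E) (v : seq E) : F :=
  ssum (fun a w => ssum (fun b c => f (a ++ m b :: c)) w) v.

(** The factor fed to m lies to the left of x, contains x, or lies to its right. *)
Lemma insertion_slot f m a x c :
  insertion f m (a ++ x :: c) =
    ssum (fun a1 w => ssum (fun a2 a3 => f (a1 ++ m a2 :: a3 ++ x :: c)) w) a +
    ssum (fun a1 a2 => ssum (fun c1 c2 => f (a1 ++ m (a2 ++ x :: c1) :: c2)) c) a +
    ssum (fun c1 w => ssum (fun c2 c3 => f (a ++ x :: c1 ++ m c2 :: c3)) w) c.
Proof.
rewrite /insertion ssum_cat_cons; congr (_ + _).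
  by rewrite -ssumD; apply: eq_ssum => a1 a2 _; rewrite ssum_cat_cons.
by apply: eq_ssum => c1 w _; apply: eq_ssum => c2 c3 _; rewrite -catA.
Qed.

Lemma insertion_multilinear f m :
  multilinear f -> multilinear m -> multilinear (insertion f m).
Proof.
move=> fl ml; apply: F2_multilinear => a c x y; rewrite !insertion_slot.
have -> : forall p q r p' q' r' : F,
  p + q + r + (p' + q' + r') = (p + p') + (q + q') + (r + r') by move=> *; char2.
congr (_ + _ + _); rewrite -ssumD; apply: eq_ssum => u w _; rewrite -ssumD;
  apply: eq_ssum => u' w' _.
- by have := multilinearD fl (u ++ m u' :: w') c x y; rewrite -!catA.
- by rewrite (multilinearD ml) (multilinearD fl).
- exact: multilinearD.
Qed.

End Insertion.

(** Two successive insertions are either disjoint or nested. Disjoint ones occur once in each order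
    and cancel in characteristic 2; in coalgebra terms, the square of a coderivation is a
    coderivation. *)
Lemma insertion_insertion (E F : grVectType) (f : seq E -> F) (m : seq E -> E) v :
  multilinear f ->
  insertion (insertion f m) m v = insertion f (insertion m m) v.
Proof.
move=> fl.
pose dis a b c d e := f (a ++ m b :: c ++ m d :: e).
pose nest a b c d e := f (a ++ m (b ++ m c :: d) :: e).
have -> : insertion (insertion f m) m v =
    ssum (fun a w => ssum (fun b c =>
      ssum (fun a1 w1 => ssum (fun a2 a3 => dis a1 a2 a3 b c) w1) a) w) v +
    ssum (fun a w => ssum (fun b c =>
      ssum (fun a1 a2 => ssum (fun c1 c2 => nest a1 a2 b c1 c2) c) a) w) v +
    ssum (fun a w => ssum (fun b c =>
      ssum (fun c1 w1 => ssum (fun c2 c3 => dis a b c1 c2 c3) w1) c) w) v.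
  rewrite -!ssumD; apply: eq_ssum => a w _; rewrite -!ssumD.
  by apply: eq_ssum => b c _; rewrite insertion_slot.
have -> : insertion f (insertion m m) v =
    ssum (fun a w => ssum (fun u c2 => ssum (fun a2 w' => ssum (fun b c1 =>
      nest a a2 b c1 c2) w') u) w) v.
  apply: eq_ssum => a w _; apply: eq_ssum => u c _; rewrite /insertion.
  rewrite (@raddf_ssum _ _ _ (fun x => f (a ++ x :: c))); last 2 first.
  - exact: multilinear0.
  - exact: multilinearD.
  apply: eq_ssum => a2 w' _.
  by rewrite (@raddf_ssum _ _ _ (fun x => f (a ++ x :: c))) //;
    [exact: multilinear0 | exact: multilinearD].
have cancel2 (p q r : F) : p = r -> p + q + r = q by move=> ->; char2.
rewrite cancel2; last first.
- under eq_ssum => a w _ do rewrite exchange_ssum.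
  rewrite -(ssumA (fun a1 w1 w => ssum (fun b c =>
    ssum (fun a2 a3 => dis a1 a2 a3 b c) w1) w)).
  apply: eq_ssum => a x _; under eq_ssum => w1 w _ do rewrite exchange_ssum.
  by rewrite -(ssumA (fun a2 a3 w => ssum (fun b c => dis a a2 a3 b c) w)).
under eq_ssum => a w _ do rewrite exchange_ssum.
rewrite -(ssumA (fun a1 a2 w => ssum (fun b c =>
  ssum (fun c1 c2 => nest a1 a2 b c1 c2) c) w)).
apply: eq_ssum => a w _.
rewrite -(ssumA (fun a2 w' c2 => ssum (fun b c1 => nest a a2 b c1 c2) w')).
by apply: eq_ssum => a2 y _; rewrite -(ssumA (fun b c1 c2 => nest a a2 b c1 c2)).
Qed.

Section CupProduct.
Variables (E : grVectType) (C : dgaType).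
Implicit Types f g : seq E -> C.

(** Convolution product for the deconcatenation coproduct. Cuts with an empty factor contribute
    nothing once both functions vanish at [[::]]. *)
Definition word_cup f g (v : seq E) : C := ssum (fun a b => f a * g b) v.

Lemma word_cup_multilinear f g :
  multilinear f -> multilinear g -> multilinear (word_cup f g).
Proof.
move=> fl gl; apply: F2_multilinear => a c x y; rewrite /word_cup !ssum_cat_cons.
rewrite addrACA -!ssumD; congr (_ + _); apply: eq_ssum => u w _.
  by rewrite multilinearD // mulrDr.
by rewrite multilinearD // mulrDl.
Qed.

Lemma word_cupDl f f' g v :
  word_cup (fun w => f w + f' w) g v = word_cup f g v + word_cup f' g v.
Proof. by rewrite -ssumD; apply: eq_ssum => a b _; rewrite mulrDl. Qed.

Lemma word_cupDr f g g' v :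
  word_cup f (fun w => g w + g' w) v = word_cup f g v + word_cup f g' v.
Proof. by rewrite -ssumD; apply: eq_ssum => a b _; rewrite mulrDr. Qed.

Lemma word_cupA f g h v :
  word_cup f (word_cup g h) v = word_cup (word_cup f g) h v.
Proof.
transitivity (ssum (fun a w => ssum (fun b c => f a * g b * h c) w) v).
  apply: eq_ssum => a w _; rewrite (@raddf_ssum _ _ _ ( *%R (f a))) ?mulr0 //.
    by apply: eq_ssum => b c _; rewrite mulrA.
  by move=> x y; rewrite mulrDr.
rewrite (ssumA (fun a b c => f a * g b * h c)).
apply: eq_ssum => w c _; rewrite (@raddf_ssum _ _ _ ( *%R^~ (h c))) ?mul0r //.
by move=> x y; rewrite mulrDl.
Qed.

Lemma diff_word_cup f g v :
  diff (word_cup f g v) =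
  word_cup (fun w => diff (f w)) g v + word_cup f (fun w => diff (g w)) v.
Proof.
rewrite (@raddf_ssum _ _ _ (@diff C)); last 2 first.
- exact: raddf0.
- by move=> x y; rewrite raddfD.
by rewrite -ssumD; apply: eq_ssum => a b _; rewrite leibniz.
Qed.

Lemma diff_insertion f (m : seq E -> E) v :
  diff (insertion f m v) = insertion (fun w => diff (f w)) m v.
Proof.
rewrite (@raddf_ssum _ _ _ (@diff C)); last 2 first.
- exact: raddf0.
- by move=> x y; rewrite raddfD.
apply: eq_ssum => a w _; rewrite (@raddf_ssum _ _ _ (@diff C)) ?raddf0 //.
by move=> x y; rewrite raddfD.
Qed.

(** Insertion is a derivation of the convolution product: the letter produced by m falls into the
    left or into the right factor. *)
Lemma insertion_word_cup f g (m : seq E -> E) v :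
  insertion (word_cup f g) m v =
  word_cup (insertion f m) g v + word_cup f (insertion g m) v.
Proof.
have -> : word_cup (insertion f m) g v =
    ssum (fun w d => ssum (fun a x => ssum (fun b c => f (a ++ m b :: c) * g d) x) w) v.
  apply: eq_ssum => w d _; rewrite (@raddf_ssum _ _ _ ( *%R^~ (g d))) ?mul0r //; last first.
    by move=> x y; rewrite mulrDl.
  apply: eq_ssum => a x _; rewrite (@raddf_ssum _ _ _ ( *%R^~ (g d))) ?mul0r //.
  by move=> y z; rewrite mulrDl.
have -> : word_cup f (insertion g m) v =
    ssum (fun d w => ssum (fun a x => ssum (fun b c => f d * g (a ++ m b :: c)) x) w) v.
  apply: eq_ssum => d w _; rewrite (@raddf_ssum _ _ _ ( *%R (f d))) ?mulr0 //; last first.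
    by move=> x y; rewrite mulrDr.
  apply: eq_ssum => a x _; rewrite (@raddf_ssum _ _ _ ( *%R (f d))) ?mulr0 //.
  by move=> y z; rewrite mulrDr.
have -> : insertion (word_cup f g) m v =
    ssum (fun a w => ssum (fun b c => ssum (fun a1 a2 => f a1 * g (a2 ++ m b :: c)) a) w) v +
    ssum (fun a w => ssum (fun b c => ssum (fun c1 c2 => f (a ++ m b :: c1) * g c2) c) w) v.
  rewrite -!ssumD; apply: eq_ssum => a w _; rewrite -!ssumD.
  by apply: eq_ssum => b c _; rewrite /word_cup ssum_cat_cons.
rewrite addrC; congr (_ + _).
  rewrite -(ssumA (fun a x d => ssum (fun b c => f (a ++ m b :: c) * g d) x)).
  apply: eq_ssum => a w _.
  by rewrite -(ssumA (fun b c d => f (a ++ m b :: c) * g d)).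
under eq_ssum => a w _ do rewrite exchange_ssum.
by rewrite -(ssumA (fun a1 a2 w => ssum (fun b c => f a1 * g (a2 ++ m b :: c)) w)).
Qed.

Lemma insertionD f g (m : seq E -> E) v :
  insertion (fun w => f w + g w) m v = insertion f m v + insertion g m v.
Proof. by rewrite -ssumD; apply: eq_ssum => a w _; rewrite -ssumD. Qed.

(* It vanishes on nonempty words iff f is a morphism of A_oo-algebras. *)
Definition defect f (m : seq E -> E) v :=
  insertion f m v + diff (f v) + word_cup f f v.

Lemma defect_multilinear f m :
  multilinear f -> multilinear m -> multilinear (defect f m).
Proof.
move=> fl ml; apply: F2_multilinear => a c x y; rewrite /defect.
rewrite (multilinearD (insertion_multilinear fl ml)) (multilinearD fl).
rewrite (multilinearD (word_cup_multilinear fl fl)) raddfD /=; char2.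
Qed.

(* A Bianchi identity: it makes the first nonzero defect a cocycle. *)
Lemma insertion_defect f m v : multilinear f ->
  insertion (defect f m) m v =
  insertion f (insertion m m) v + diff (defect f m v) +
  word_cup (defect f m) f v + word_cup f (defect f m) v.
Proof.
move=> fl; rewrite {1}/defect.
rewrite (insertionD (fun w => insertion f m w + diff (f w))) insertionD.
rewrite insertion_insertion // insertion_word_cup -diff_insertion.
rewrite /defect !(word_cupDl, word_cupDr) !raddfD /= diff_diff diff_word_cup.
rewrite -word_cupA; char2.
Qed.

End CupProduct.

(** * Homotopies and degrees *)

(** Additivity keeps the components chosen through h multilinear, and homogeneity keeps them
    graded. *)
Record coboundary_section (V : complexType) (h : V -> V) : Prop := {
  section_diff : forall w, diff (h (diff w)) = diff w;
  sectionD : forall u w, h (diff u + diff w) = h (diff u) + h (diff w);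
  section_homogeneous : forall i w,
    diff w \in homogeneous i -> h (diff w) \in homogeneous (i - 1)
}.

(* By Zorn's lemma there is a maximal graded subspace meeting the cocycles
   trivially; it is a complement of the cocycles. *)
Lemma coboundary_section_exists (V : complexType) :
  exists h : V -> V, coboundary_section h.
Proof.
pose P (A : V -> Prop) := [/\ forall x y, A x -> A y -> A (x + y),
  forall i x, A x -> A (gproj i x) & forall x, A x -> diff x = 0 -> x = 0].
have [A [[AD Ag Ad] Amax]] : exists A, P A /\ forall B, classical_sets.proper A B -> ~ P B.
  apply: (@classical_sets.Zorn_bigcup V P) => F FP Ftot; split.
  - move=> x y [X FX Xx] [Y FY Yy]; have [XY|YX] := Ftot X Y FX FY.
      by exists Y => //; have [YD _ _] := FP _ FY; apply: YD => //; apply: XY.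
    by exists X => //; have [XD _ _] := FP _ FX; apply: XD => //; apply: YX.
  - by move=> i x [X FX Xx]; exists X => //; have [_ Xg _] := FP _ FX; apply: Xg.
  - by move=> x [X FX Xx]; have [_ _ Xd] := FP _ FX; apply: Xd.
(* [P] does not ask for 0, so that the union of an empty chain satisfies it; the empty set itself is
   not maximal, since {0} satisfies [P]. *)
have A0 : A 0.
  have [[x Ax]|nA] := pselect (exists x, A x); first by rewrite -(F2_addvv x); apply: AD.
  case: (Amax (fun x => x = 0)).
    split; first by move=> x Ax; case: nA; exists x.
    by move=> /(_ 0 erefl) A0; case: nA; exists 0.
  by split=> [x y -> ->|i x ->|//]; rewrite ?addr0 ?raddf0.
have compl_homog i v : v \in homogeneous i -> exists2 g, A g & diff (v + g) = 0.
  move=> /homogeneousP vi; apply: contrapT => nv.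
  have nAv : ~ A v by move=> Av; apply: nv; exists v; rewrite // F2_addvv raddf0.
  (* Otherwise the span of A and v contradicts maximality: it is graded because v is homogeneous,
     and it contains no nonzero cocycle. *)
  apply: (Amax (fun x => A x \/ A (x + v))).
    split; first by move=> x Ax; left.
    by move=> /(_ v) H; apply: nAv; apply: H; right; rewrite F2_addvv.
  split=> [x y [Ax|Ax] [Ay|Ay]|j x [Ax|Ax]|x [Ax|Ax] dx].
  - by left; apply: AD.
  - by right; rewrite -addrA; apply: AD.
  - by right; rewrite addrAC; apply: AD.
  - by left; have := AD _ _ Ax Ay; congr A; char2.
  - by left; apply: Ag.
  - have := Ag j _ Ax; rewrite raddfD /= -{1}vi gprojK vi.
    by case: eqP => _; [right | rewrite addr0; left].
  - exact: Ad.
  - case: nv; exists (x + v) => //; rewrite -[RHS]dx; congr diff; char2.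
have compl v : exists2 g, A g & diff (v + g) = 0.
  have [s _ ->] := gproj_sum v; elim: s => [|i s [g Ag' dg]].
    by exists 0; rewrite // big_nil addr0 raddf0.
  have [g' Ag'' dg'] := compl_homog i _ (homogeneous_gproj i v).
  exists (g' + g); first exact: AD.
  by rewrite big_cons addrACA raddfD /= dg dg' addr0.
(* A primitive lying in A is unique, which makes the choice of h additive and homogeneous. *)
have inj g g' : A g -> A g' -> diff g = diff g' -> g = g'.
  move=> Ag1 Ag2 e; apply: F2_addv_eq0; apply: Ad; first exact: AD.
  by rewrite raddfD /= e F2_addvv.
pose h v := if pselect (exists g, A g /\ diff g = v) is left e then sval (cid e) else 0.
have hP w : A (h (diff w)) /\ diff (h (diff w)) = diff w.
  rewrite /h; case: pselect => [e|[]]; first by case: cid.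
  have [g Ag' dg] := compl w; exists g; split => //.
  by apply: F2_addv_eq0; rewrite -raddfD addrC.
exists h; split=> [w|u w|i w wi]; first by have [] := hP w.
  rewrite -raddfD; have [A1 d1] := hP (u + w); have [A2 d2] := hP u; have [A3 d3] := hP w.
  by apply: inj => //; [apply: AD | rewrite d1 !raddfD /= d2 d3].
have [A1 d1] := hP w; apply/homogeneousP; apply: inj => //; first exact: Ag.
by rewrite diff_gproj subrK d1; apply/homogeneousP.
Qed.

Section WordDegrees.

Lemma homogeneous_ssum (E : Type) (V : grVectType) i (G : seq E -> seq E -> V) v :
  (forall a b, a ++ b = v -> G a b \in homogeneous i) -> ssum G v \in homogeneous i.
Proof.
elim: v G => [|x v IHv] G hG /=.
  by rewrite addr0; apply: hG.
apply: homogeneousD; first exact: hG.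
by apply: IHv => a b e; apply: hG; rewrite /= e.
Qed.

Lemma unzip2_cat (S T : Type) (vs : seq (S * T)) a b : a ++ b = unzip2 vs ->
  exists va vb, [/\ vs = va ++ vb, a = unzip2 va & b = unzip2 vb].
Proof.
move=> e; exists (take (size a) vs), (drop (size a) vs).
by rewrite cat_take_drop /unzip2 map_take map_drop -/(unzip2 vs) -e take_size_cat // drop_size_cat.
Qed.

(** With n letters, |b| of them fed to m, the shifts add up to k - (n - |b| + 1) + l - |b| = k + l -
    1 - n. *)
Lemma insertion_multigraded (E F : grVectType) k l (f : seq E -> F) (m : seq E -> E) :
  m [::] = 0 -> multilinear f -> multigraded k f -> multigraded l m ->
  multigraded (k + l - 1) (insertion f m).
Proof.
move=> m0 fl fg mg vs _ hvs.
apply: homogeneous_ssum => a w /unzip2_cat [va [vw [evs -> ->]]].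
apply: homogeneous_ssum => b c /unzip2_cat [vb [vc [ew -> ->]]].
case: vb => [|u vb] in ew *; first by rewrite m0 (multilinear0 fl) homogeneous0.
move: hvs; rewrite evs ew !all_cat => /andP[ha /andP[hb hc]].
have hm := mg (u :: vb) isT hb.
set d := (X in homogeneous X) in hm.
have pos : (0 < size (va ++ (d, m (unzip2 (u :: vb))) :: vc))%N by rewrite size_cat addnS.
have := fg _ pos; rewrite all_cat ha [all _ (_ :: vc)]/= hm hc => /(_ isT).
rewrite [in X in X -> _]/unzip2 map_cat; congr (_ \in homogeneous _).
have sizeS (T : Type) (x : T) s : (size (x :: s))%:Z = (size s)%:Z + 1 by rewrite /= -addn1 PoszD.
rewrite /d !big_cat !big_cons !size_cat !PoszD !sizeS /=; ring.
Qed.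

Lemma word_cup_multigraded (E : grVectType) (C : dgaType) k l (f g : seq E -> C) :
  f [::] = 0 -> g [::] = 0 -> multigraded k f -> multigraded l g ->
  multigraded (k + l) (word_cup f g).
Proof.
move=> f0 g0 fg gg vs _ hvs.
apply: homogeneous_ssum => a b /unzip2_cat [va [vb [evs -> ->]]].
case: va => [|x va] in evs *; first by rewrite f0 mul0r homogeneous0.
case: vb => [|y vb] in evs *; first by rewrite g0 mulr0 homogeneous0.
move: hvs; rewrite evs all_cat => /andP[ha hb].
have := homogeneousM _ _ _ _ (fg (x :: va) isT ha) (gg (y :: vb) isT hb).
congr (_ \in homogeneous _); rewrite big_cat size_cat PoszD /=; ring.
Qed.

Lemma defect_multigraded (E : grVectType) (C : dgaType) (f : seq E -> C) (m : seq E -> E) :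
  f [::] = 0 -> m [::] = 0 -> multilinear f -> multigraded 1 f -> multigraded 2 m ->
  multigraded 2 (defect f m).
Proof.
move=> f0 m0 fl fg mg vs vs0 hvs; rewrite /defect !homogeneousD //.
- by have := insertion_multigraded m0 fl fg mg vs0 hvs.
- have := diff_homogeneous _ _ (fg vs vs0 hvs); congr (_ \in homogeneous _); ring.
- by have := word_cup_multigraded f0 f0 fg fg vs0 hvs.
Qed.

End WordDegrees.

(** * Which values of f and m enter an insertion *)

Section Locality.
Variables (E F : grVectType).
Implicit Types (f g : seq E -> F) (m p : seq E -> E).

Lemma ssum_whole (V : zmodType) (G : seq E -> seq E -> seq E -> V) v :
  (forall a b c, a ++ b ++ c = v -> (size b < size v)%N -> G a b c = 0) ->
  ssum (fun a w => ssum (fun b c => G a b c) w) v = G [::] v [::].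
Proof.
case: v => [|x v] G0; first by rewrite /= !addr0.
rewrite [LHS]/= [X in _ + X]ssum_eq0; last first.
  move=> a w e; apply: ssum_eq0 => b c e'; apply: G0; first by rewrite e' /= e.
  by rewrite -e -e' /= ltnS !size_cat addnCA leq_addr.
rewrite addr0 (G0 [::] [::]) // add0r ssumE big_nat_recr //= take_size drop_size.
rewrite big_nat_cond big1 ?add0r // => k /andP[/= kv _].
by apply: G0; rewrite /= ?cat_take_drop // ltnS size_takel // ltnW.
Qed.

(** An empty factor would lengthen the word; since m and p vanish at [[::]] it contributes nothing,
    and f is only evaluated on words no longer than v. *)
Lemma eq_insertion f g m p v : m [::] = 0 -> p [::] = 0 ->
  multilinear f -> multilinear g ->
  (forall u, (size u <= size v)%N -> f u = g u) ->
  (forall u, (size u <= size v)%N -> m u = p u) ->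
  insertion f m v = insertion g p v.
Proof.
move=> m0 p0 fl gl fg mp; apply: eq_ssum => a w ea; apply: eq_ssum => b c eb.
case: b => [|x b] in eb *; first by rewrite m0 p0 !multilinear0.
have sv : size v = (size a + (size (x :: b) + size c))%N by rewrite -ea -eb !size_cat.
rewrite mp ?sv; last by rewrite addnCA leq_addr.
by apply: fg; rewrite sv size_cat leq_add2l /= addSn ltnS leq_addl.
Qed.

(** As m vanishes on words of length at most 1, the words fed to f are strictly shorter than v. *)
Lemma insertion_eq0 f m n v : m [::] = 0 -> (forall x, m [:: x] = 0) ->
  multilinear f -> (forall u, (0 < size u <= n)%N -> f u = 0) ->
  (size v <= n.+1)%N -> insertion f m v = 0.
Proof.
move=> m0 m1 fl f0 sv; apply: ssum_eq0 => a w ea; apply: ssum_eq0 => b c eb.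
case: b => [|x [|y b]] in eb *; rewrite ?m0 ?m1 ?multilinear0 //.
apply: f0; rewrite size_cat addnS /= -ltnS; apply: leq_trans sv.
by rewrite -ea -eb !size_cat /= !addSn !addnS !ltnS leq_add2l leq_addl.
Qed.

Lemma insertion_whole f m v : multilinear f ->
  (forall u, (size u < size v)%N -> m u = 0) ->
  insertion f m v = f [:: m v].
Proof.
move=> fl m0; rewrite /insertion (ssum_whole (G := fun a b c => f (a ++ m b :: c))) //.
by move=> a b c _ sb; rewrite m0 // multilinear0.
Qed.

Lemma insert_sumE f m v : m [::] = 0 -> multilinear f ->
  insert_sum f m v = insertion f m v.
Proof.
move=> m0 fl; rewrite /insertion ssumE big_nat_recr //= drop_size /= m0.
rewrite multilinear0 // !addr0 /insert_sum; apply: eq_bigr => r _.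
rewrite ssumE size_drop [RHS]big_nat_recl // take0 m0 multilinear0 // add0r.
rewrite big_add1 /=; apply: eq_bigr => s _.
by rewrite /insert_op drop_drop addnC.
Qed.

End Locality.

(** * The morphism equation with values in a DGA *)

Section SplitSumDGA.
Variables (E : grVectType) (C : dgaType) (f : seq E -> C).
Hypothesis f0 : f [::] = 0.

Lemma word_cup_eq0 (g : seq E -> C) n v : (forall u, (size u <= n)%N -> g u = 0) ->
  (size v <= n.+1)%N -> word_cup g f v = 0 /\ word_cup f g v = 0.
Proof.
move=> g0 sv; split; apply: ssum_eq0 => a b e.
  case: b => [|x b] in e *; first by rewrite f0 mulr0.
  rewrite g0 ?mul0r // -ltnS; apply: leq_trans sv.
  by rewrite -e size_cat /= addnS ltnS leq_addr.
case: a => [|x a] in e *; first by rewrite f0 mul0r.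
rewrite g0 ?mulr0 // -ltnS; apply: leq_trans sv.
by rewrite -e size_cat /= addSn ltnS leq_addl.
Qed.

Lemma split_sum_dga v : (0 < size v)%N ->
  split_sum (dga_ainf C) f v = diff (f v) + word_cup f f v.
Proof.
set n := size v => v0.
have big3 q : (2 < q)%N -> \sum_(i : q.-tuple 'I_n.+1 |
    all (leq 1) (map val i) && (sumn (map val i) == n))
    dga_ainf C (map f (reshape (map val i) v)) = 0.
  move=> q2; apply: big1 => i _; apply: dga_op_gt2.
  by rewrite size_map size_reshape size_map size_tuple.
have sum1 : \sum_(i : 1.-tuple 'I_n.+1 |
    all (leq 1) (map val i) && (sumn (map val i) == n))
    dga_ainf C (map f (reshape (map val i) v)) = diff (f v).
  rewrite (bigD1 [tuple of [:: ord_max]]) /=; last by rewrite v0 addn0 eqxx.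
  rewrite big1 ?addr0 ?take_size // => i /andP[/andP[_]].
  case/tupleP: i => a t; rewrite tuple0 /= addn0 => /eqP e /negP[].
  by apply/eqP/val_inj => /=; congr [:: _]; apply/val_inj.
have sum2 : \sum_(i : 2.-tuple 'I_n.+1 |
    all (leq 1) (map val i) && (sumn (map val i) == n))
    dga_ainf C (map f (reshape (map val i) v)) = word_cup f f v.
  rewrite /word_cup ssumE big_mkord.
  rewrite (bigID (fun k : 'I_n.+1 => (0 < k < n)%N)) /= [X in _ = _ + X]big1 ?addr0; last first.
    move=> k; rewrite negb_and -leqNgt leqn0 -leqNgt => /orP[/eqP->|nk].
      by rewrite take0 f0 mul0r.
    by rewrite drop_oversize // f0 mulr0.
  (* A pair of sizes adding up to n is determined by its first entry, so the cuts at 0 < k < n match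
     the pairs k, n - k. *)
  rewrite (reindex_onto (fun k : 'I_n.+1 => [tuple k; rev_ord k])
    (fun t : 2.-tuple 'I_n.+1 => thead t)) /=; last first.
    move=> i; case/tupleP: i => a i; case/tupleP: i => b t; rewrite tuple0 /= addn0.
    move=> /andP[_ /eqP e]; apply/val_inj => /=; rewrite theadE; congr [:: _; _].
    by apply/val_inj; rewrite /= subSS -[n in (n - _)%N]e addKn.
  apply: eq_big => k.
    have kn : (k <= n)%N by rewrite -ltnS.
    have -> : thead [tuple k; rev_ord k] = k by [].
    by rewrite subSS andbT addn0 subnKC // subn_gt0 (eqxx n) (eqxx k) !andbT.
  move=> _; rewrite subSS; congr (_ * f _).
  by rewrite take_oversize // size_drop.
(* For n = 1 the range stops at q = 1, and the sum for q = 2 is empty because two positive sizes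
   exceed 1; hence the convolution square is 0 as well. *)
rewrite /split_sum -/n; case: n v0 big3 sum1 sum2 => // -[|n] _ big3 sum1 sum2.
  rewrite big_nat1 sum1.
  rewrite -[word_cup f f v]sum2 big1 ?addr0 // => i.
  case/tupleP: i => a i; case/tupleP: i => b t; rewrite tuple0 /= addn0.
  by case: a b => [[|a] ?] [[|b] ?] //=; rewrite addnS.
rewrite big_ltn // big_ltn // sum1 sum2 big_nat_cond big1 ?addr0 // => q.
by rewrite andbT => /andP[q2 _]; apply: big3.
Qed.

End SplitSumDGA.

(** * Kadeishvili's construction *)

Section ClassOf.
Variable V : complexType.

(* The value outside the cocycles is irrelevant. *)
Definition class_of (v : V) : cohomology V :=
  if insub v is Some z then class (z : cocycle V) else 0.

Lemma class_of_val (z : cocycle V) : class_of z = class z.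
Proof. by rewrite /class_of valK. Qed.

Lemma class_ofD (u v : V) : diff u = 0 -> diff v = 0 ->
  class_of (u + v) = class_of u + class_of v.
Proof.
move=> /eqP du /eqP dv.
rewrite (class_of_val (Cocycle du)) (class_of_val (Cocycle dv)) -raddfD.
exact: (class_of_val (Cocycle du + Cocycle dv)).
Qed.

Lemma class_of_eq0 (u : V) : diff u = 0 -> (class_of u = 0 <-> exists w, u = diff w).
Proof.
move=> /eqP du; rewrite (class_of_val (Cocycle du)).
have [E1 E2] := eq_class (Cocycle du) 0; rewrite raddf0 /= in E1 E2.
split=> [/E1[w e]|[w e]].
  by exists w; rewrite -[u]subr0; exact: e.
by apply: E2; exists w; rewrite -e -[u in RHS]subr0.
Qed.

Lemma class_of_homogeneous i (u : V) : diff u = 0 ->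
  u \in homogeneous i -> class_of u \in homogeneous i.
Proof.
move=> /eqP du ui; rewrite (class_of_val (Cocycle du)).
apply/homogeneousP; rewrite [gproj _ _]cohomology_gprojE; congr class.
by apply/val_inj/homogeneousP.
Qed.

Lemma class_of_homogeneous_lift i (x : cohomology V) : x \in homogeneous i ->
  exists u : V, [/\ diff u = 0, u \in homogeneous i & class_of u = x].
Proof.
move=> /homogeneousP e.
exists (gproj i (cocycle_val (repr x))); split.
- by apply/eqP/cocycle_gproj.
- exact: homogeneous_gproj.
by rewrite (class_of_val (Cocycle (cocycle_gproj i (repr x)))) -[RHS]e.
Qed.

End ClassOf.

Lemma class_ofM (C : dgaType) (u v : C) : diff u = 0 -> diff v = 0 ->
  class_of (u * v) = class_of u * class_of v.
Proof.
move=> /eqP du /eqP dv.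
rewrite (class_of_val (Cocycle du)) (class_of_val (Cocycle dv)) -classM.
exact: (class_of_val (Cocycle du * Cocycle dv)).
Qed.

Lemma class_of1 (C : dgaType) : class_of (1 : C) = 1.
Proof. exact: (class_of_val (1 : cocycle C)). Qed.

Section Kadeishvili.
Variables (C : dgaType).
Local Notation H := (cohomology C).

(** The components f_1 and f_2 of a morphism whose m_2 is the product. The last field is the
    solvability of the equation for f_3 with m_3 = 0; a choice of w that is trilinear in x, y, z is
    made later, through a [coboundary_section]. *)
Record A3_data (f1 : H -> C) (f2 : H -> H -> C) : Prop := {
  data_f1D : forall x y, f1 (x + y) = f1 x + f1 y;
  data_f1_diff : forall x, diff (f1 x) = 0;
  data_f1_class : forall x, class_of (f1 x) = x;
  data_f1_homogeneous : forall i x, x \in homogeneous i -> f1 x \in homogeneous i;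
  data_f2Dl : forall x y z, f2 (x + y) z = f2 x z + f2 y z;
  data_f2Dr : forall x y z, f2 x (y + z) = f2 x y + f2 x z;
  data_f2_homogeneous : forall i j x y, x \in homogeneous i -> y \in homogeneous j ->
    f2 x y \in homogeneous (i + j - 1);
  data_f2_diff : forall x y, diff (f2 x y) = f1 x * f1 y + f1 (x * y);
  data_f3 : forall x y z, exists w,
    f1 x * f2 y z + f2 x y * f1 z + f2 (x * y) z + f2 x (y * z) = diff w
}.

Variables (f1 : H -> C) (f2 : H -> H -> C).
Hypothesis D : A3_data f1 f2.

Lemma data_f1_0 : f1 0 = 0.
Proof. by rewrite -(F2_addvv (0 : H)) (data_f1D D) F2_addvv. Qed.

Lemma data_f2_0l x : f2 0 x = 0.
Proof. by rewrite -(F2_addvv (0 : H)) (data_f2Dl D) F2_addvv. Qed.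

Lemma data_f2_0r x : f2 x 0 = 0.
Proof. by rewrite -(F2_addvv (0 : H)) (data_f2Dr D) F2_addvv. Qed.

(** A stage of the induction. Truncation to 0 beyond n makes the defect in length n+1 the
    obstruction to choosing the next components. *)
Record morphism_upto (n : nat) (f : seq H -> C) (m : seq H -> H) : Prop := {
  upto_f_multilinear : multilinear f;
  upto_m_multilinear : multilinear m;
  upto_f_degree : multigraded 1 f;
  upto_m_degree : multigraded 2 m;
  upto_f_nil : f [::] = 0;
  upto_m_nil : m [::] = 0;
  upto_f1 : forall x, f [:: x] = f1 x;
  upto_m1 : forall x, m [:: x] = 0;
  upto_f_gt : forall v, (n < size v)%N -> f v = 0;
  upto_m_gt : forall v, (n < size v)%N -> m v = 0;
  upto_defect : forall v, (size v <= n)%N -> defect f m v = 0;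
  upto_stasheff : forall v, (size v <= n)%N -> insertion m m v = 0
}.

(** The class of the defect becomes m_(n+1); the defect corrected by f_1 of that class is a
    coboundary, and h provides its primitive f_(n+1). *)
Definition extend_m n (f : seq H -> C) (m : seq H -> H) (v : seq H) : H :=
  if size v == n.+1 then class_of (defect f m v) else m v.

Definition extend_f (h : C -> C) n (f : seq H -> C) (m : seq H -> H) (v : seq H) : C :=
  if size v == n.+1 then h (defect f m v + f1 (class_of (defect f m v))) else f v.

(** In length n+1 the Bianchi identity reduces to f_1(s) + diff(defect) = 0, where s is the Stasheff
    sum. So f_1(s) is exact, its class s vanishes, and then the defect is a cocycle. *)
Lemma defect_cocycle n f m v : (0 < n)%N -> morphism_upto n f m -> size v = n.+1 ->
  diff (defect f m v) = 0 /\ insertion m m v = 0.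
Proof.
move=> n0 U sv.
have defl := defect_multilinear (upto_f_multilinear U) (upto_m_multilinear U).
have := insertion_defect m v (upto_f_multilinear U).
rewrite (@insertion_eq0 _ _ (defect f m) m n) ?sv //; last 3 first.
- exact: upto_m_nil U.
- exact: upto_m1 U.
- by move=> u /andP[_]; apply: (upto_defect U).
have [-> ->] := word_cup_eq0 (upto_f_nil U) (upto_defect U) (eq_leq sv).
rewrite insertion_whole; last 2 first.
- exact: upto_f_multilinear U.
- by move=> u; rewrite sv ltnS; apply: (upto_stasheff U).
rewrite (upto_f1 U) !addr0 => /esym/F2_addv_eq0 e.
have e0 : insertion m m v = 0.
  rewrite -(data_f1_class D (insertion m m v)) e.
  by apply/class_of_eq0; [rewrite diff_diff | exists (defect f m v)].
by split=> //; rewrite -e e0 data_f1_0.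
Qed.

Lemma add_class_coboundary u : diff u = 0 -> exists w, u + f1 (class_of u) = diff w.
Proof.
move=> du; apply/class_of_eq0; first by rewrite raddfD /= du (data_f1_diff D) addr0.
by rewrite class_ofD ?(data_f1_diff D) // (data_f1_class D) F2_addvv.
Qed.

Lemma morphism_upto_extend h n f m : coboundary_section h -> (0 < n)%N ->
  morphism_upto n f m -> morphism_upto n.+1 (extend_f h n f m) (extend_m n f m).
Proof.
move=> hS n0 U; set f' := extend_f h n f m; set m' := extend_m n f m.
have fl := upto_f_multilinear U; have ml := upto_m_multilinear U.
have defl := defect_multilinear fl ml.
have coc v : size v = n.+1 -> diff (defect f m v) = 0.
  by move=> sv; have [] := defect_cocycle n0 U sv.
have f'E v : size v != n.+1 -> f' v = f v by rewrite /f' /extend_f => /negPf->.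
have m'E v : size v != n.+1 -> m' v = m v by rewrite /m' /extend_m => /negPf->.
have neq1 : (1 != n.+1)%N by case: (n) n0.
have f'l : multilinear f'.
  apply: F2_multilinear => s1 s2 x y; rewrite /f' /extend_f !size_cat /=.
  case: eqP => [sv|_]; last exact: multilinearD.
  have cx := coc (s1 ++ x :: s2); have cy := coc (s1 ++ y :: s2).
  rewrite !size_cat /= in cx cy.
  rewrite (multilinearD defl) class_ofD ?cx ?cy // (data_f1D D) addrACA.
  have [w ->] := add_class_coboundary (cx sv); have [w' ->] := add_class_coboundary (cy sv).
  by rewrite (sectionD hS).
have m'l : multilinear m'.
  apply: F2_multilinear => s1 s2 x y; rewrite /m' /extend_m !size_cat /=.
  case: eqP => [sv|_]; last exact: multilinearD.
  have cx := coc (s1 ++ x :: s2); have cy := coc (s1 ++ y :: s2).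
  rewrite !size_cat /= in cx cy.
  by rewrite (multilinearD defl) class_ofD ?cx ?cy.
have m'0 : m' [::] = 0 by rewrite m'E // (upto_m_nil U).
have f'0 : f' [::] = 0 by rewrite f'E // (upto_f_nil U).
have m'1 x : m' [:: x] = 0 by rewrite m'E // (upto_m1 U).
have f'1 x : f' [:: x] = f1 x by rewrite f'E // (upto_f1 U).
have defg := defect_multigraded (upto_f_nil U) (upto_m_nil U) fl (upto_f_degree U) (upto_m_degree U).
have size2 (vs : seq (int * H)) : size (unzip2 vs) = size vs by rewrite size_map.
have small v : (size v <= n)%N -> size v != n.+1 by move=> sv; rewrite neq_ltn ltnS sv.
(* Only the terms in which a factor has length n.+1 change. *)
have ins_full (F : grVectType) (g g' : seq H -> F) v : multilinear g -> multilinear g' ->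
    (forall u, size u != n.+1 -> g' u = g u) -> size v = n.+1 ->
    insertion g' m' v = insertion g m v + g' [:: m' v].
  move=> gl gl' gg' sv; apply: F2_addv_eq0; rewrite addrA.
  set S := insertion g' m' v + insertion g m v.
  suff -> : S = g' [:: m' v] by rewrite F2_addvv.
  rewrite /S -ssumD; under eq_ssum => a w _ do rewrite -ssumD.
  rewrite (ssum_whole (G := fun a b c => g' (a ++ m' b :: c) + g (a ++ m b :: c))).
    have -> : m v = 0 by apply: (upto_m_gt U); rewrite sv.
    by rewrite (multilinear0 gl [::] [::]) addr0.
  move=> a b c e; rewrite sv ltnS => sb; rewrite (m'E b) ?small //.
  case: b => [|x [|y b]] in e sb *.
  - by rewrite (upto_m_nil U) !multilinear0 // addr0.
  - by rewrite (upto_m1 U) !multilinear0 // addr0.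
  rewrite gg' ?F2_addvv //; apply: small.
  by rewrite -ltnS -sv -e !size_cat /= !addSn !addnS !ltnS leq_add2l leq_addl.
split=> //.
- move=> vs vs0 hvs; rewrite /f' /extend_f size2; case: eqP => [sv|_]; last exact: (upto_f_degree U).
  have cv := coc (unzip2 vs); rewrite size2 in cv.
  have [w ew] := add_class_coboundary (cv sv).
  have : diff w \in homogeneous (\sum_(u <- vs) u.1 + (2 - (size vs)%:Z)).
    rewrite -ew homogeneousD ?(data_f1_homogeneous D) ?class_of_homogeneous ?cv //.
    - exact: defg.
    - exact: defg.
  rewrite ew => /(section_homogeneous hS); congr (_ \in homogeneous _); ring.
- move=> vs vs0 hvs; rewrite /m' /extend_m size2; case: eqP => [sv|_]; last exact: (upto_m_degree U).
  by rewrite class_of_homogeneous ?coc ?size2 ?defg.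
- by move=> v sv; rewrite f'E ?(upto_f_gt U) ?(ltnW sv) // gtn_eqF.
- by move=> v sv; rewrite m'E ?(upto_m_gt U) ?(ltnW sv) // gtn_eqF.
- move=> v; rewrite leq_eqVlt ltnS => /orP[/eqP sv|sv].
    have cupE : word_cup f' f' v = word_cup f f v.
      apply: eq_ssum => a b e.
      case: a => [|x a] in e *; first by rewrite f'0 (upto_f_nil U) !mul0r.
      case: b => [|y b] in e *; first by rewrite f'0 (upto_f_nil U) !mulr0.
      rewrite !f'E // small // -ltnS -sv -e size_cat /= !(addSn, addnS) !ltnS; [exact: leq_addl | exact: leq_addr].
    have -> : defect f' m' v = defect f m v + f1 (m' v) + diff (f' v).
      rewrite /defect (ins_full _ f f') // cupE f'1 (upto_f_gt U (v := v)) ?sv //.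
      rewrite [diff 0]raddf0; char2.
    rewrite /f' /m' /extend_f /extend_m sv eqxx.
    have [w ->] := add_class_coboundary (coc v sv).
    by rewrite (section_diff hS) F2_addvv.
  rewrite -[RHS](upto_defect U sv) /defect f'E ?small //.
  congr (_ + _ + _).
    apply: eq_insertion; rewrite ?(upto_m_nil U) // => u su; rewrite ?f'E ?m'E // small //; exact: leq_trans sv.
  by apply: eq_ssum => a b e; rewrite !f'E // small // (leq_trans _ sv) // -e size_cat ?leq_addl ?leq_addr.
- move=> v; rewrite leq_eqVlt ltnS => /orP[/eqP sv|sv].
    (* The new components are composed only with m_1, which is 0: the relation in length n+1 already
       holds for the old maps. *)
    rewrite (ins_full _ m m') // m'1 addr0; by have [] := defect_cocycle n0 U sv.
  rewrite -[RHS](upto_stasheff U sv).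
  apply: eq_insertion; rewrite ?(upto_m_nil U) // => u su; rewrite ?m'E // small //; exact: leq_trans sv.
Qed.

End Kadeishvili.

(** * The minimal model as a limit *)

Section MinimalModel.
Variables (C : dgaType).
Local Notation H := (cohomology C).
Variables (f1 : H -> C) (f2 : H -> H -> C).
Hypothesis D : A3_data f1 f2.

Definition base_f (v : seq H) : C :=
  match v with [:: x] => f1 x | [:: x; y] => f2 x y | _ => 0 end.

Definition base_m (v : seq H) : H := if v is [:: x; y] then x * y else 0.

Lemma morphism_upto2 : morphism_upto f1 2 base_f base_m.
Proof.
have f0 := (data_f1_0 D, data_f2_0l D, data_f2_0r D).
split=> //.
- apply: F2_multilinear => -[|a [|b s1]] [|c s2] x y /=.
  + exact: (data_f1D D).
  + by case: s2 => [|? ?]; rewrite ?addr0 // (data_f2Dl D).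
  + by rewrite (data_f2Dr D).
  + by rewrite addr0.
  + by case: s1 => [|? ?]; rewrite addr0.
  + by case: s1 => [|? ?]; rewrite addr0.
- apply: F2_multilinear => -[|a [|b s1]] [|c s2] x y /=; rewrite ?addr0 //.
  + by case: s2 => [|? ?]; rewrite ?addr0 // mulrDl.
  + by rewrite mulrDr.
  + by case: s1 => [|? ?]; rewrite addr0.
  + by case: s1 => [|? ?]; rewrite addr0.
- move=> [|[i x] [|[j y] [|? ?]]] //= _; rewrite ?andbT.
  + by move=> xi; rewrite big_seq1 subrr addr0 (data_f1_homogeneous D).
  + move=> /andP[xi yj]; rewrite !big_cons big_nil addr0.
    exact: (data_f2_homogeneous D).
  + by rewrite homogeneous0.
- move=> [|[i x] [|[j y] [|? ?]]] //= _; rewrite ?andbT.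
  + by rewrite homogeneous0.
  + move=> /andP[xi yj]; rewrite !big_cons big_nil !addr0.
    exact: cohomology_homogeneousM.
  + by rewrite homogeneous0.
- by move=> [|? [|? [|? ?]]].
- by move=> [|? [|? [|? ?]]].
- move=> [|x [|y [|? ?]]] //= _; rewrite /defect /insertion /word_cup /= ?raddf0.
  + by rewrite ?(f0, mul0r, mulr0, addr0, add0r).
  + by rewrite (data_f1_diff D) ?(f0, mul0r, mulr0, addr0, add0r).
  + by rewrite (data_f2_diff D) ?(f0, mul0r, mulr0, addr0, add0r); char2.
- move=> [|x [|y [|? ?]]] //= _; rewrite /insertion /=.
  + by rewrite ?addr0.
  + by rewrite ?(mul0r, mulr0, addr0, add0r).
  + by rewrite ?(mul0r, mulr0, addr0, add0r).
Qed.

Lemma base_defect3 x y z : defect base_f base_m [:: x; y; z] =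
  f1 x * f2 y z + f2 x y * f1 z + f2 (x * y) z + f2 x (y * z).
Proof.
have f0 := (data_f1_0 D, data_f2_0l D, data_f2_0r D).
rewrite /defect /insertion /word_cup /= ?raddf0.
rewrite ?(f0, mul0r, mulr0, addr0, add0r); char2.
Qed.

Variable h : C -> C.
Hypothesis hS : coboundary_section h.

(** Stage n is correct up to length n+2: f_1, f_2 and m_2 are given, and the first extension
    produces m_3. *)
Fixpoint tower (n : nat) : (seq H -> C) * (seq H -> H) :=
  if n is k.+1 then
    (extend_f f1 h k.+2 (tower k).1 (tower k).2, extend_m k.+2 (tower k).1 (tower k).2)
  else (base_f, base_m).

Lemma tower_upto n : morphism_upto f1 n.+2 (tower n).1 (tower n).2.
Proof.
elim: n => [|n IHn]; first exact: morphism_upto2.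
exact: (morphism_upto_extend D hS _ IHn).
Qed.

Lemma tower_stable n k v : (size v <= n.+2)%N ->
  (tower (n + k)).1 v = (tower n).1 v /\ (tower (n + k)).2 v = (tower n).2 v.
Proof.
move=> sv; elim: k => [|k [IH1 IH2]]; first by rewrite addn0.
rewrite addnS /= /extend_f /extend_m ifN ?ifN //.
all: by rewrite neq_ltn (leq_trans (n := n.+3)) // !ltnS leq_addr.
Qed.

(** Stage n is final on words of length at most n+2, so every word may be read at the stage numbered
    by its own length. *)
Definition limit_f (v : seq H) : C := (tower (size v)).1 v.
Definition limit_m (v : seq H) : H := (tower (size v)).2 v.

Lemma limitE n v : (size v <= n.+2)%N ->
  limit_f v = (tower n).1 v /\ limit_m v = (tower n).2 v.
Proof.
move=> sv; rewrite /limit_f /limit_m; have [le|/ltnW le] := leqP (size v) n.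
  by have := @tower_stable (size v) (n - size v) v (leqW (leqnSn _)); rewrite subnKC // => -[-> ->].
by have [] := tower_stable (size v - n) sv; rewrite subnKC.
Qed.

Lemma limit_fE n v : (size v <= n.+2)%N -> limit_f v = (tower n).1 v.
Proof. by case/limitE. Qed.

Lemma limit_mE n v : (size v <= n.+2)%N -> limit_m v = (tower n).2 v.
Proof. by case/limitE. Qed.

Lemma limit_f_multilinear : multilinear limit_f.
Proof.
apply: F2_multilinear => s1 s2 x y; rewrite /limit_f !size_cat /=.
exact/multilinearD/(upto_f_multilinear (tower_upto _)).
Qed.

Lemma limit_m_multilinear : multilinear limit_m.
Proof.
apply: F2_multilinear => s1 s2 x y; rewrite /limit_m !size_cat /=.
exact/multilinearD/(upto_m_multilinear (tower_upto _)).
Qed.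

Lemma limit_m0 : limit_m [::] = 0.
Proof. exact: (upto_m_nil (tower_upto _)). Qed.

Lemma limit_f0 : limit_f [::] = 0.
Proof. exact: (upto_f_nil (tower_upto _)). Qed.

Lemma limit_f1 x : limit_f [:: x] = f1 x.
Proof. exact: (upto_f1 (tower_upto _)). Qed.

Lemma limit_m1 x : limit_m [:: x] = 0.
Proof. exact: (upto_m1 (tower_upto _)). Qed.

Lemma limit_f_degree : multigraded 1 limit_f.
Proof. by move=> vs vs0 hvs; apply: (upto_f_degree (tower_upto _)). Qed.

Lemma limit_m_degree : multigraded 2 limit_m.
Proof. by move=> vs vs0 hvs; apply: (upto_m_degree (tower_upto _)). Qed.

Lemma limit_insertion (F : grVectType) (g p : seq H -> F) v :
  multilinear g -> multilinear p ->
  (forall u, (size u <= size v)%N -> g u = p u) ->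
  insertion g limit_m v = insertion p (tower (size v)).2 v.
Proof.
move=> gl pl gp; apply: eq_insertion; rewrite ?limit_m0 ?(upto_m_nil (tower_upto _)) //.
by move=> u su; apply: limit_mE; apply: (leq_trans su); rewrite ltnW.
Qed.

Lemma limit_stasheff v : (0 < size v)%N -> insert_sum limit_m limit_m v = 0.
Proof.
move=> _; rewrite insert_sumE ?limit_m0 //; last exact: limit_m_multilinear.
rewrite (limit_insertion limit_m_multilinear (upto_m_multilinear (tower_upto (size v)))).
  by rewrite (upto_stasheff (tower_upto _)) // ltnW.
by move=> u su; apply: limit_mE; apply: (leq_trans su); rewrite ltnW.
Qed.

Lemma limit_morphism v : (0 < size v)%N ->
  insert_sum limit_f limit_m v = split_sum (dga_ainf C) limit_f v.
Proof.
move=> v0; rewrite insert_sumE ?limit_m0 //; last exact: limit_f_multilinear.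
rewrite (split_sum_dga limit_f0) //; apply: F2_addv_eq0; rewrite addrA.
have U := tower_upto (size v).
have fE u : (size u <= size v)%N -> limit_f u = (tower (size v)).1 u.
  by move=> su; apply: limit_fE; apply: (leq_trans su); rewrite ltnW.
rewrite (limit_insertion limit_f_multilinear (upto_f_multilinear U)) //.
rewrite -[RHS](upto_defect U (v := v)); last by rewrite ltnW.
congr (_ + _ + _).
by apply: eq_ssum => a b e; rewrite !fE // -e size_cat ?leq_addl ?leq_addr.
Qed.

Definition limit_structure : ainf_structure H :=
  AInfStructure limit_m_multilinear limit_m_degree limit_stasheff.

Definition limit_map : ainf_morphism limit_structure (dga_ainf C) :=
  @AInfMorphism H C limit_structure (dga_ainf C) limit_f limit_f_multilinear limit_f_degree limit_morphism.

(** With m_1 = 0 the source complex is its own cohomology, and the claim becomes that f_1 picks one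
    cocycle in each class. *)
Lemma limit_quasi_iso : ainf_quasi_iso limit_map.
Proof.
set g := ainf_chain_map limit_map.
have gE (z : cocycle (ainf_complex limit_structure)) : g (cocycle_val z) = f1 (cocycle_val z).
  exact: limit_f1.
have dE (w : ainf_complex (dga_ainf C)) : diff w = diff (w : C) by [].
have g_inj : injective (cohomology_map g).
  move=> x x'; rewrite -(class_repr x) -(class_repr x').
  move: (repr x) (repr x') => z z'; rewrite !cohomology_mapE => /eq_class[w e0].
  have e : f1 (cocycle_val z) + f1 (cocycle_val z') = diff (w : C).
    by rewrite -!gE -[X in _ + X]F2_oppv; exact: e0.
  suff e' : cocycle_val z = cocycle_val z' by congr class; apply: val_inj.
  rewrite -(data_f1_class D (cocycle_val z)) -(data_f1_class D (cocycle_val z')).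
  apply: F2_addv_eq0; rewrite -class_ofD ?(data_f1_diff D) // e.
  by apply/class_of_eq0; [rewrite diff_diff | exists w].
have cocH (x : ainf_complex limit_structure) : x \in @cocycle_pred (ainf_complex limit_structure).
  by apply/eqP; apply: limit_m1.
have g_surj y : exists x, cohomology_map g x = y.
  rewrite -(class_repr y); move: (repr y) => z.
  have dz : diff (cocycle_val z : C) = 0 := diff_cocycle z.
  exists (class (Cocycle (cocH (class_of (cocycle_val z : C))))).
  rewrite cohomology_mapE; apply/eq_class.
  have [w e] := add_class_coboundary D dz; exists w; rewrite dE -e -(gE (Cocycle (cocH (class_of (cocycle_val z : C))))) [RHS]addrC.
  by rewrite -[X in _ = _ + X]F2_oppv.
pose g' y := sval (cid (g_surj y)).
have gK y : cohomology_map g (g' y) = y by rewrite /g'; case: cid.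
by exists g' => // x; apply: g_inj; rewrite gK.
Qed.

(** The component m_3 is the class of the defect of the initial stage, which [data_f3] makes
    exact. *)
Lemma limit_m3 x y z : limit_m [:: x; y; z] = 0.
Proof.
rewrite (@limit_mE 1) //= /extend_m /= base_defect3.
have [w ->] := data_f3 D x y z.
by apply/class_of_eq0; [rewrite diff_diff | exists w].
Qed.

End MinimalModel.

Theorem A3_formal_criterion (C : dgaType) f1 f2 : @A3_data C f1 f2 -> A3_formal C.
Proof.
move=> D; have [h hS] := coboundary_section_exists C.
exists (@MinimalModel C (limit_structure D hS) (limit_m1 D hS) _ (limit_quasi_iso D hS)) => x y z.
exact: (limit_m3 D).
Qed.

(** * Massey products *)

Ltac expand := rewrite ?(mulrDl, mulrDr, mulrA).

Section MasseyVanishing.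
Variables (C : dgaType) (f1 : cohomology C -> C).
Variable f2 : cohomology C -> cohomology C -> C.
Hypothesis D : A3_data f1 f2.

Lemma data_cobounding (z : cocycle C) x : class z = x ->
  exists p, cocycle_val z = f1 x + diff p.
Proof.
move=> <-; have [w ew] := add_class_coboundary D (diff_cocycle z).
by exists w; rewrite -ew class_of_val; char2.
Qed.

(** Nonemptiness comes from f2 itself. The cocycles of any defining system differ from f1 x, f1 y,
    f1 z by coboundaries of p, q, r; corrected by these, the differences e, e' of the cobounding
    cochains are cocycles. The Massey class is x [e'] + [e] z, because [data_f3] makes the class of
    the standard system zero. *)
Lemma massey_vanishes_of_data (x y z : cohomology C) : x * y = 0 -> y * z = 0 -> massey_vanishes x y z.
Proof.
move=> xy yz; have f0 := (data_f1_0 D, data_f2_0l D, data_f2_0r D).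
have dxy : diff (f2 x y) = f1 x * f1 y by rewrite (data_f2_diff D) xy f0 addr0.
have dyz : diff (f2 y z) = f1 y * f1 z by rewrite (data_f2_diff D) yz f0 addr0.
have coc a : f1 a \in @cocycle_pred C by apply/eqP/(data_f1_diff D).
have clE a : class (Cocycle (coc a)) = a by rewrite -class_of_val (data_f1_class D).
split; first by exists (massey_class (DefiningSystem (clE x) (clE y) (clE z) dxy dyz));
  exists (DefiningSystem (clE x) (clE y) (clE z) dxy dyz).
move=> w [[X Y Z Exy Eyz eX eY eZ dExy dEyz] ->].
have [p eXp] := data_cobounding eX; have [q eYq] := data_cobounding eY.
have [r eZr] := data_cobounding eZ.
have de : diff (Exy + f2 x y + p * cocycle_val Y + f1 x * q) = 0.
  rewrite !raddfD /= !leibniz dExy dxy diff_cocycle (data_f1_diff D) eXp eYq.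
  by expand; rewrite ?(mul0r, mulr0, addr0, add0r); char2.
have de' : diff (Eyz + f2 y z + q * cocycle_val Z + f1 y * r) = 0.
  rewrite !raddfD /= !leibniz dEyz dyz diff_cocycle (data_f1_diff D) eYq eZr.
  by expand; rewrite ?(mul0r, mulr0, addr0, add0r); char2.
set e := _ + f1 x * q in de; set e' := _ + f1 y * r in de'.
exists (class_of e'), (class_of e); rewrite /massey_class -class_of_val /=.
have [u eu] := data_f3 D x y z; rewrite xy yz !f0 !addr0 in eu.
rewrite -[X in _ = X * _ + _](data_f1_class D x) -[X in _ = _ + _ * X](data_f1_class D z).
rewrite -!class_ofM ?(data_f1_diff D) // -class_ofD; last 2 first.
- by rewrite leibniz de' (data_f1_diff D) mul0r mulr0 addr0.
- by rewrite leibniz de (data_f1_diff D) mul0r mulr0 addr0.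
apply: F2_addv_eq0; rewrite -class_ofD; last 2 first.
- by have /eqP := massey_cocycle (DefiningSystem eX eY eZ dExy dEyz).
- by rewrite raddfD /= !leibniz de de' !(data_f1_diff D) !(mul0r, mulr0) !addr0.
have E : cocycle_val X * Eyz + Exy * cocycle_val Z + (f1 x * e' + e * f1 z) =
    diff (p * Eyz + f2 x y * r + e * r + u).
  rewrite !raddfD /= !leibniz dEyz dxy de -eu eXp.
  have -> : Exy = e + f2 x y + p * cocycle_val Y + f1 x * q by rewrite /e; char2.
  have -> : Eyz = e' + f2 y z + q * cocycle_val Z + f1 y * r by rewrite /e'; char2.
  rewrite eZr.
  by expand; rewrite ?(mul0r, mulr0, addr0, add0r); char2.
rewrite E; apply/class_of_eq0; first by rewrite diff_diff.
by exists (p * Eyz + f2 x y * r + e * r + u).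
Qed.

End MasseyVanishing.

(** * The monomials of F_2[a,b,c]/(ab,bc) *)

Section MonomialBasis.
Local Notation P := {mpoly 'F_2[3]}.
Local Notation i0 := (inord 0 : 'I_3).
Local Notation i1 := (inord 1 : 'I_3).
Local Notation i2 := (inord 2 : 'I_3).

Lemma eq_inord3 (i j : nat) : (i < 3)%N -> (j < 3)%N ->
  (inord i == inord j :> 'I_3) = (i == j).
Proof. by move=> hi hj; rewrite -val_eqE /= !inordK. Qed.

Lemma abc_ab : abc_a * abc_b = 0.
Proof.
rewrite -rmorphM -(raddf0 abc_pi); apply/eq_abc_pi; rewrite subr0.
by apply/abc_idealP; exists 1, 0; rewrite mul1r mul0r addr0.
Qed.

Lemma abc_bc : abc_b * abc_c = 0.
Proof.
rewrite -rmorphM -(raddf0 abc_pi); apply/eq_abc_pi; rewrite subr0.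
by apply/abc_idealP; exists 0, 1; rewrite mul1r mul0r add0r.
Qed.

Lemma abc_pi_monomial (m : 'X_{1..3}) :
  abc_pi 'X_[m] = abc_a ^+ m i0 * abc_b ^+ m i1 * abc_c ^+ m i2.
Proof.
rewrite mpolyXE_id !big_ord_recl big_ord0 mulr1 !rmorphM !rmorphXn mulrA.
have e0 : ord0 = i0 by apply/val_inj; rewrite /= inordK.
have e1 : lift ord0 ord0 = i1 by apply/val_inj; rewrite /= inordK.
have e2 : lift ord0 (lift ord0 ord0) = i2 by apply/val_inj; rewrite /= inordK.
by rewrite e2 e1 e0.
Qed.

(** Monomials divisible by ab or bc vanish, which leaves the a^i c^j, with 1 among them, and the
    positive powers of b; over F_2 linear combinations are sums. *)
Lemma abc_ind (S : F2abc -> Prop) :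
  (forall x y, S x -> S y -> S (x + y)) ->
  (forall i j, S (abc_a ^+ i * abc_c ^+ j)) -> (forall k, S (abc_b ^+ k.+1)) ->
  forall x, S x.
Proof.
move=> SD Sac Sb x; have S0 : S 0.
  by rewrite -(F2_addvv (abc_a ^+ 0 * abc_c ^+ 0)); apply: SD.
rewrite -(abc_pi_repr x) (mpolyE (repr x)) raddf_sum /=.
elim: (msupp _) => [|m s IHs]; rewrite ?big_nil // big_cons; apply: SD => //.
have [->|->] := F2_cases (repr x)@_m; first by rewrite scale0r raddf0.
rewrite scale1r abc_pi_monomial.
case: (m i1) => [|k]; first by rewrite expr0 mulr1.
case: (m i0) => [|i]; last first.
  by rewrite exprSr [abc_b ^+ _]exprS mulrA -[_ * abc_a * abc_b]mulrA abc_ab mulr0 !mul0r.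
case: (m i2) => [|j]; first by rewrite expr0 mul1r mulr1.
by rewrite expr0 mul1r exprSr exprS mulrA -[_ * abc_b * abc_c]mulrA abc_bc mulr0 !mul0r.
Qed.

Section LinearExtension.
Variable W : lmodType 'F_2.
Implicit Types (g : nat -> nat -> W) (h : nat -> W).

(** Monomials divisible by ab or bc are sent to 0, so that the extension descends to the
    quotient. *)
Definition monomial_image g h (m : 'X_{1..3}) : W :=
  if m i1 == 0%N then g (m i0) (m i2)
  else if (m i0 == 0%N) && (m i2 == 0%N) then h (m i1).-1 else 0.

Definition mpoly_extend g h (p : P) : W :=
  \sum_(m <- msupp p) p@_m *: monomial_image g h m.

(* The linear map sending a^i c^j to g i j and b^(k+1) to h k. *)
Definition abc_extend g h (x : F2abc) : W := mpoly_extend g h (repr x).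

(** Additivity needs a common index set, as the supports of p, q and p + q differ. *)
Lemma mpoly_extendE k g h p : (msize p <= k)%N ->
  mpoly_extend g h p = \sum_(m : 'X_{1..3 < k}) p@_m *: monomial_image g h m.
Proof.
move=> pk; rewrite /mpoly_extend (big_mksub ('X_{1..3 < k} : subFinType _)) //=; first last.
- by move=> m /msize_mdeg_lt /leq_trans; apply.
- exact: msupp_uniq.
by rewrite big_rmcond //= => m; move/memN_msupp_eq0 ->; rewrite scale0r.
Qed.

Lemma mpoly_extendD g h p q :
  mpoly_extend g h (p + q) = mpoly_extend g h p + mpoly_extend g h q.
Proof.
pose k := maxn (msize (p + q)) (maxn (msize p) (msize q)).
rewrite !(@mpoly_extendE k) ?leq_max ?leqnn ?orbT // -big_split /=.
by apply: eq_bigr => m _; rewrite mcoeffD scalerDl.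
Qed.

Lemma mpoly_extendX g h m : mpoly_extend g h 'X_[m] = monomial_image g h m.
Proof. by rewrite /mpoly_extend msuppX big_seq1 mcoeffX eqxx scale1r. Qed.

Lemma mpoly_extend0 g h : mpoly_extend g h 0 = 0.
Proof. by rewrite /mpoly_extend msupp0 big_nil. Qed.

Lemma mpoly_extend_mul0 g h (q : P) (m' : 'X_{1..3}) :
  (forall m, monomial_image g h (m + m')%MM = 0) -> mpoly_extend g h (q * 'X_[m']) = 0.
Proof.
move=> z; rewrite (mpolyE q) mulr_suml.
elim: (msupp _) => [|m s IHs]; rewrite ?big_nil ?mpoly_extend0 // big_cons.
rewrite mpoly_extendD IHs addr0.
have [->|->] := F2_cases q@_m; first by rewrite scale0r mul0r mpoly_extend0.
by rewrite scale1r -mpolyXD mpoly_extendX z.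
Qed.

Lemma abc_extend_pi g h p : abc_extend g h (abc_pi p) = mpoly_extend g h p.
Proof.
apply: F2_addv_eq0; rewrite -mpoly_extendD.
have : repr (abc_pi p) + p \in abc_ideal.
  by rewrite -[p in _ + p]F2_oppv; apply/eq_abc_pi; rewrite abc_pi_repr.
move=> /abc_idealP[q [r ->]]; rewrite -!mpolyXD mpoly_extendD.
rewrite !mpoly_extend_mul0 ?addr0 // => m; rewrite /monomial_image !mnmDE !mnm1E !eq_inord3 //=.
  by rewrite !addn0 addn1 add0n addn1 andbF.
by rewrite !addn0 add0n !addn1.
Qed.

Lemma abc_extendD g h x y :
  abc_extend g h (x + y) = abc_extend g h x + abc_extend g h y.
Proof.
rewrite -(abc_pi_repr x) -(abc_pi_repr y) -raddfD !abc_extend_pi.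
exact: mpoly_extendD.
Qed.

Lemma abc_extend_ac g h i j : abc_extend g h (abc_a ^+ i * abc_c ^+ j) = g i j.
Proof.
rewrite /abc_a /abc_c -!rmorphXn -rmorphM abc_extend_pi !mpolyXn.
rewrite -mpolyXD mpoly_extendX /monomial_image !mnmDE !mulmnE !mnm1E.
by rewrite !eq_inord3 //= !mul0n !mul1n addn0.
Qed.

Lemma abc_extend_b g h k : abc_extend g h (abc_b ^+ k.+1) = h k.
Proof.
rewrite /abc_b -rmorphXn abc_extend_pi mpolyXn.
rewrite mpoly_extendX /monomial_image !mulmnE !mnm1E.
by rewrite !eq_inord3 //=; congr h; exact: addn0.
Qed.

End LinearExtension.

Lemma abc_gproj_ac d i j : gproj d (abc_a ^+ i * abc_c ^+ j : F2abc) =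
  if d == (i + j)%N then abc_a ^+ i * abc_c ^+ j else 0.
Proof.
rewrite /abc_a /abc_c -!rmorphXn -rmorphM [gproj _ _]abc_gprojE !mpolyXn -mpolyXD.
rewrite (@mpoly_gproj_homog _ (i + j)%N); last first.
  by rewrite dhomogX /= mdegD !mdegMn !mdeg1 !mul1n.
by case: eqP => // _; rewrite raddf0.
Qed.

Lemma abc_gproj_b d k : gproj d (abc_b ^+ k : F2abc) =
  if d == k then abc_b ^+ k else 0.
Proof.
rewrite /abc_b -!rmorphXn [gproj _ _]abc_gprojE !mpolyXn.
rewrite (@mpoly_gproj_homog _ k); last by rewrite dhomogX /= mdegMn mdeg1 mul1n.
by case: eqP => // _; rewrite raddf0.
Qed.

Lemma abc_a_homogeneous : abc_a \in homogeneous 1.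
Proof.
by apply/homogeneousP; have := abc_gproj_ac 1 1 0; rewrite expr0 expr1 mulr1.
Qed.

Lemma abc_b_homogeneous : abc_b \in homogeneous 1.
Proof. by apply/homogeneousP; have := abc_gproj_b 1 1; rewrite expr1. Qed.

Lemma abc_c_homogeneous : abc_c \in homogeneous 1.
Proof.
by apply/homogeneousP; have := abc_gproj_ac 1 0 1; rewrite expr0 expr1 mul1r.
Qed.

End MonomialBasis.

(** * Explicit homotopies *)

Section Exact.
Variable C : dgaType.
Implicit Types u w x : C.

Definition exact w := exists u, w = diff u.

Lemma exact0 : exact 0.
Proof. by exists 0; rewrite raddf0. Qed.

Lemma exact_diff u : exact (diff u).
Proof. by exists u. Qed.

Lemma exactD u w : exact u -> exact w -> exact (u + w).
Proof. by move=> [u' ->] [w' ->]; exists (u' + w'); rewrite raddfD. Qed.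

Lemma exactMl x w : diff x = 0 -> exact w -> exact (x * w).
Proof. by move=> dx [u ->]; exists (x * u); rewrite leibniz dx mul0r add0r. Qed.

Lemma exactMr x w : diff x = 0 -> exact w -> exact (w * x).
Proof. by move=> dx [u ->]; exists (u * x); rewrite leibniz dx mulr0 addr0. Qed.

Lemma diff_expr x n : diff x = 0 -> diff (x ^+ n) = 0.
Proof.
move=> dx; elim: n => [|n IHn]; first exact: dga_diff1.
by rewrite exprS leibniz dx IHn mul0r mulr0 addr0.
Qed.

End Exact.

Section ExplicitHomotopy.
Variables (C : dgaType) (A B G Eab Eba Ebc Ecb E : C).
Hypotheses (dA : diff A = 0) (dB : diff B = 0) (dG : diff G = 0).
Hypotheses (dEab : diff Eab = A * B) (dEba : diff Eba = B * A).
Hypotheses (dEbc : diff Ebc = B * G) (dEcb : diff Ecb = G * B).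
Hypothesis dE : diff E = A * G + G * A.
Hypotheses (aba : exact (A * Eba + Eab * A)) (cbc : exact (G * Ebc + Ecb * G)).
Hypotheses (abc : exact (A * Ebc + Eab * G)) (cba : exact (G * Eba + Ecb * A)).
Hypotheses (bab : exact (B * Eab + Eba * B)) (bcb : exact (B * Ecb + Ebc * B)).
Hypothesis cab : exact (G * Eab + E * B + A * Ecb).
Hypothesis bca : exact (B * E + Eba * G + Ebc * A).

Fixpoint comm1 k : C := if k is l.+1 then comm1 l * A + A ^+ l * E else 0.

(* The homotopy between G^j A^k and A^k G^j. *)
Fixpoint comm j k : C := if j is l.+1 then G * comm l k + comm1 k * G ^+ l else 0.

Lemma diff_comm1 k : diff (comm1 k) = G * A ^+ k + A ^+ k * G.
Proof.
elim: k => [|k IHk] /=; first by rewrite raddf0 expr0 mulr1 mul1r F2_addvv.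
rewrite raddfD /= !leibniz IHk (diff_expr k dA) dA dE exprSr mul0r mulr0.
by expand; char2.
Qed.

Lemma comm1D k l : comm1 (k + l) = comm1 k * A ^+ l + A ^+ k * comm1 l.
Proof.
elim: l => [|l IHl]; first by rewrite addn0 expr0 mulr1 mulr0 addr0.
by rewrite addnS /= IHl exprSr exprD; expand; char2.
Qed.

Lemma comm1Sl k : comm1 k.+1 = E * A ^+ k + A * comm1 k.
Proof. by rewrite -[k.+1]add1n comm1D /= mul0r add0r expr0 mul1r expr1. Qed.

Lemma diff_comm j k : diff (comm j k) = G ^+ j * A ^+ k + A ^+ k * G ^+ j.
Proof.
elim: j => [|j IHj] /=; first by rewrite raddf0 expr0 mulr1 mul1r F2_addvv.
rewrite raddfD /= !leibniz IHj diff_comm1 (diff_expr j dG) dG mul0r mulr0 exprS.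
by expand; char2.
Qed.

Lemma commD j l k : comm (j + l) k = G ^+ j * comm l k + comm j k * G ^+ l.
Proof.
elim: j => [|j IHj]; first by rewrite add0n expr0 mul1r mul0r addr0.
by rewrite addSn /= IHj exprS exprD; expand; char2.
Qed.

Lemma commSr j k : comm j.+1 k = G ^+ j * comm1 k + comm j k * G.
Proof. by rewrite -addn1 commD /= mulr0 add0r expr0 mulr1 expr1. Qed.

Lemma comm0r j : comm j 0 = 0.
Proof. by elim: j => [|j IHj] //=; rewrite IHj mulr0 mul0r addr0. Qed.

Lemma expr_swap (x y : C) n : x * y * y ^+ n = x * y ^+ n * y.
Proof. by rewrite -!mulrA -exprS -exprSr. Qed.

Ltac normalize_words := rewrite
  ?(exprSr, expr0, mulrDl, mulrDr, mulrA, mul1r, mulr1, mul0r, mulr0, addr0, add0r);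
  rewrite ?expr_swap.

Ltac diff_simp :=
  rewrite ?raddfD /= ?leibniz ?diff_comm ?diff_comm1 ?dEab ?dEba ?dEbc ?dEcb ?dE
    ?(fun k => diff_expr k dA) ?(fun k => diff_expr k dB) ?(fun k => diff_expr k dG)
    ?dA ?dB ?dG; normalize_words.

(** For j = 1 the sum is 0, [comm1] being a derivation. In general, the swaps of one c with a^k and
    of the remaining c's with a^m can be done in either order, and the product of the two homotopies
    bounds the difference. *)
Lemma exact_commD j k m :
  exact (comm j k * A ^+ m + A ^+ k * comm j m + comm j (k + m)).
Proof.
elim: j => [|j IHj] /=; first by rewrite mul0r mulr0 !addr0; apply: exact0.
have := exactD (exactMl dG IHj) (exact_diff (comm1 k * comm j m)).
congr exact; rewrite comm1D; diff_simp; char2.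
Qed.

(** [commD] and [exact_commD] split the homotopies of composite powers; what remains are two swaps
    at disjoint places, c^j with a^k and c^l with a^m, performed in either order. *)
Lemma exact_ac_ac_ac i j k l m n :
  exact (A ^+ i * G ^+ j * (A ^+ k * comm l m * G ^+ n) +
         A ^+ i * comm j k * G ^+ l * (A ^+ m * G ^+ n) +
         A ^+ (i + k) * comm (j + l) m * G ^+ n +
         A ^+ i * comm j (k + m) * G ^+ (l + n)).
Proof.
have := exactMr (diff_expr n dG) (exactMl (diff_expr i dA)
  (exactD (exact_diff (comm j k * comm l m)) (exactMr (diff_expr l dG) (exact_commD j k m)))).
congr exact; rewrite commD !exprD; diff_simp; char2.
Qed.

(* Null-homotopies of (A^i G^j) B and B (A^i G^j), for i + j > 0. *)
Definition null_l i j : C :=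
  if j is l.+1 then A ^+ i * G ^+ l * Ecb
  else if i is k.+1 then A ^+ k * Eab else 0.

Definition null_r i j : C :=
  if i is k.+1 then Eba * A ^+ k * G ^+ j
  else if j is l.+1 then Ebc * G ^+ l else 0.

Lemma diff_null_l i j : (0 < i + j)%N -> diff (null_l i j) = A ^+ i * G ^+ j * B.
Proof. by case: i j => [|i] [|j] // _; rewrite /null_l; diff_simp. Qed.

Lemma diff_null_r i j : (0 < i + j)%N -> diff (null_r i j) = B * (A ^+ i * G ^+ j).
Proof. by case: i j => [|i] [|j] // _; rewrite /null_r; diff_simp. Qed.

(** Only the letters next to b matter, the last of a^i c^j and the first of a^k c^l; the four cases
    are the brackets abc, aba, cbc and cba multiplied by monomials on both sides. *)
Lemma exact_ac_b_ac i j k l : (0 < i + j)%N -> (0 < k + l)%N ->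
  exact (A ^+ i * G ^+ j * null_r k l + null_l i j * (A ^+ k * G ^+ l)).
Proof.
move=> ij kl; have ex_l w : exact w -> forall p q, exact (A ^+ p * G ^+ q * w).
  by move=> ew p q; rewrite -mulrA; apply: exactMl (exactMl _ ew); apply: diff_expr.
have ex_r w : exact w -> forall p q, exact (w * A ^+ p * G ^+ q).
  by move=> ew p q; apply: exactMr (exactMr _ ew); apply: diff_expr.
case: j k ij kl => [|j] [|k]; rewrite ?(addn0, add0n).
- case: i l => [|i] [|l] // _ _; have := ex_r _ (ex_l _ abc i 0%N) 0%N l.
  by congr exact; rewrite /null_l /null_r; normalize_words; char2.
- case: i => [|i] // _ _; have := ex_r _ (ex_l _ aba i 0%N) k l.
  by congr exact; rewrite /null_l /null_r; normalize_words; char2.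
- case: l => [|l] // _ _; have := ex_r _ (ex_l _ cbc i j) 0%N l.
  by congr exact; rewrite /null_l /null_r; normalize_words; char2.
move=> _ _; have := ex_r _ (ex_l _ cba i j) k l.
by congr exact; rewrite /null_l /null_r; normalize_words; char2.
Qed.

(** For a single letter this is a bracket. Otherwise the two null-homotopies use different letters,
    and applying both at once gives a primitive. *)
Lemma exact_b_ac_b i j : (0 < i + j)%N ->
  exact (B * null_l i j + null_r i j * B).
Proof.
case: i j => [|i] [|j] // _; rewrite /null_l /null_r.
- case: j => [|j]; first by normalize_words.
  have := exact_diff (Ebc * G ^+ j * Ecb); congr exact; diff_simp; char2.
- case: i => [|i]; first by normalize_words.
  have := exact_diff (Eba * A ^+ i * Eab); congr exact; diff_simp; char2.
have := exact_diff (Eba * A ^+ i * G ^+ j * Ecb); congr exact; diff_simp; char2.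
Qed.

(** Two ways of killing c^(j+1) a^(k+1) b: through ab at once, or through cb after moving the power
    of c next to b. The bracket of cab is the case j = k = 0. *)
Lemma exact_cab j k :
  exact (G ^+ j.+1 * (A ^+ k * Eab) + comm j.+1 k.+1 * B + A ^+ k.+1 * G ^+ j * Ecb).
Proof.
elim: j => [|j IHj].
  have := exactD (exactMl (diff_expr k dA) cab) (exact_diff (comm1 k * Eab)).
  congr exact; rewrite /comm [comm1 k.+1]/=; diff_simp; char2.
have := exactD (exactMl dG IHj) (exact_diff (comm1 k.+1 * G ^+ j * Ecb)).
congr exact; rewrite -[comm j.+2 k.+1]/(G * comm j.+1 k.+1 + comm1 k.+1 * G ^+ j.+1).
rewrite [G ^+ j.+2]exprS.
have dc := diff_comm1 k.+1; move: (comm1 k.+1) (comm j.+1 k.+1) dc => c d dc.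
rewrite !leibniz dc; diff_simp; char2.
Qed.

(** Mirror image: b c^(j+1) a^(k+1) is killed through bc at once, or through ba after the swap. *)
Lemma exact_bca j k :
  exact (B * comm j.+1 k.+1 + Ebc * G ^+ j * A ^+ k.+1 + Eba * A ^+ k * G ^+ j.+1).
Proof.
elim: j => [|j IHj].
  have := exactD (exactMr (diff_expr k dA) bca) (exact_diff (Eba * comm1 k)).
  congr exact; rewrite /comm comm1Sl; diff_simp; char2.
have := exactD (exactMr dG IHj) (exact_diff (Ebc * G ^+ j * comm1 k.+1)).
congr exact; rewrite (commSr j.+1).
have dc := diff_comm1 k.+1; move: (comm1 k.+1) (comm j.+1 k.+1) dc => c d dc.
rewrite !leibniz dc; diff_simp; char2.
Qed.

(** A bracket enters only if the first monomial contains c and the second is a power of a: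
    reordering then changes the letter next to b from a to c. Otherwise [null_l] uses the same
    null-homotopy before and after. *)
Lemma exact_ac_ac_b i j k l : (0 < k + l)%N ->
  exact (A ^+ i * G ^+ j * null_l k l + A ^+ i * comm j k * G ^+ l * B +
         null_l (i + k) (j + l)).
Proof.
case: l => [|l].
  case: k => [|k] // _; case: j => [|j].
    suff -> : A ^+ i * G ^+ 0 * null_l k.+1 0 + A ^+ i * comm 0 k.+1 * G ^+ 0 * B +
      null_l (i + k.+1) (0 + 0) = 0 by apply: exact0.
    by rewrite addnS addn0 -[comm 0 k.+1]/(0 : C) /null_l exprD; normalize_words; char2.
  have := exactMl (diff_expr i dA) (exact_cab j k).
  congr exact; rewrite addn0 /null_l exprD; set d := comm _ _; normalize_words; char2.
move=> _; have := exactMl (diff_expr i dA) (exact_diff (comm j k * G ^+ l * Ecb)).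
congr exact; rewrite addnS /null_l !exprD; diff_simp; char2.
Qed.

Lemma exact_b_ac_ac i j k l : (0 < i + j)%N ->
  exact (B * (A ^+ i * comm j k * G ^+ l) + null_r i j * (A ^+ k * G ^+ l) +
         null_r (i + k) (j + l)).
Proof.
case: i => [|i].
  case: j => [|j] // _; case: k => [|k].
    suff -> : B * (A ^+ 0 * comm j.+1 0 * G ^+ l) + null_r 0 j.+1 * (A ^+ 0 * G ^+ l) +
      null_r (0 + 0) (j.+1 + l) = 0 by apply: exact0.
    by rewrite addSn addn0 comm0r /null_r exprD; normalize_words; char2.
  have := exactMr (diff_expr l dG) (exact_bca j k).
  congr exact; rewrite add0n /null_r exprD; set d := comm _ _; normalize_words; char2.
move=> _; have := exactMr (diff_expr l dG) (exact_diff (Eba * A ^+ i * comm j k)).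
congr exact; rewrite addSn /null_r !exprD; diff_simp; char2.
Qed.

End ExplicitHomotopy.

(** * Normalization of the null-homotopies *)

Section Coefficients.

Definition coef_ac i j (x : F2abc) : ('F_2)^o :=
  abc_extend (fun k l => ((k == i) && (l == j))%:R : ('F_2)^o) (fun=> 0) x.

(* The coefficient of b^(k+1). *)
Definition coef_b k (x : F2abc) : ('F_2)^o :=
  abc_extend (fun _ _ => 0 : ('F_2)^o) (fun l => (l == k)%:R) x.

Lemma coef_acD i j x y : coef_ac i j (x + y) = coef_ac i j x + coef_ac i j y.
Proof. exact: abc_extendD. Qed.

Lemma coef_bD k x y : coef_b k (x + y) = coef_b k x + coef_b k y.
Proof. exact: abc_extendD. Qed.

Lemma coef_ac0 i j : coef_ac i j 0 = 0.
Proof. by rewrite -(F2_addvv (1 : F2abc)) coef_acD F2_addvv. Qed.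

Lemma coef_b0 k : coef_b k 0 = 0.
Proof. by rewrite -(F2_addvv (1 : F2abc)) coef_bD F2_addvv. Qed.

Lemma coef_acZ i j (t : 'F_2) x : coef_ac i j (t *: x) = t *: coef_ac i j x.
Proof. by have [->|->] := F2_cases t; rewrite ?scale0r ?coef_ac0 ?scale1r. Qed.

Lemma coef_bZ k (t : 'F_2) x : coef_b k (t *: x) = t *: coef_b k x.
Proof. by have [->|->] := F2_cases t; rewrite ?scale0r ?coef_b0 ?scale1r. Qed.

Lemma coef_ac_ac i j k l :
  coef_ac i j (abc_a ^+ k * abc_c ^+ l) = ((k == i) && (l == j))%:R.
Proof. exact: abc_extend_ac. Qed.

Lemma coef_ac_b i j k : coef_ac i j (abc_b ^+ k.+1) = 0.
Proof. exact: abc_extend_b. Qed.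

Lemma coef_b_ac i k l : coef_b i (abc_a ^+ k * abc_c ^+ l) = 0.
Proof. exact: abc_extend_ac. Qed.

Lemma coef_b_b i k : coef_b i (abc_b ^+ k.+1) = (k == i)%:R.
Proof. exact: abc_extend_b. Qed.

Lemma abc_mul_a i j : abc_a * (abc_a ^+ i * abc_c ^+ j) = abc_a ^+ i.+1 * abc_c ^+ j.
Proof. by rewrite mulrA -exprS. Qed.

Lemma abc_mul_c i j : abc_c * (abc_a ^+ i * abc_c ^+ j) = abc_a ^+ i * abc_c ^+ j.+1.
Proof. by rewrite mulrCA -exprS. Qed.

Lemma abc_mul_ab k : abc_a * abc_b ^+ k.+1 = 0.
Proof. by rewrite exprS mulrA abc_ab mul0r. Qed.

Lemma abc_mul_cb k : abc_c * abc_b ^+ k.+1 = 0.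
Proof. by rewrite exprS mulrA [abc_c * _]mulrC abc_bc mul0r. Qed.

Lemma abc_mul_b_ac i j : (0 < i + j)%N -> abc_b * (abc_a ^+ i * abc_c ^+ j) = 0.
Proof.
case: i => [|i]; last by move=> _; rewrite exprS !mulrA [abc_b * _]mulrC abc_ab !mul0r.
by case: j => // j _; rewrite expr0 mul1r exprS mulrA abc_bc mul0r.
Qed.

Lemma coef_ac_mula i j x :
  coef_ac i j (abc_a * x) = if i is k.+1 then coef_ac k j x else 0.
Proof.
elim/abc_ind: x => [x y IHx IHy|k l|k].
- by rewrite mulrDr coef_acD IHx IHy; case: i {IHx IHy} => [|i]; rewrite ?addr0 ?coef_acD.
- by rewrite abc_mul_a coef_ac_ac; case: i => [|i] //; rewrite coef_ac_ac.
by rewrite abc_mul_ab coef_ac0; case: i => [|i] //; rewrite coef_ac_b.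
Qed.

Lemma coef_ac_mulc i j x :
  coef_ac i j (abc_c * x) = if j is l.+1 then coef_ac i l x else 0.
Proof.
elim/abc_ind: x => [x y IHx IHy|k l|k].
- by rewrite mulrDr coef_acD IHx IHy; case: j {IHx IHy} => [|j]; rewrite ?addr0 ?coef_acD.
- by rewrite abc_mul_c coef_ac_ac; case: j => [|j] //; rewrite ?coef_ac_ac ?andbF.
by rewrite abc_mul_cb coef_ac0; case: j => [|j] //; rewrite coef_ac_b.
Qed.

Lemma coef_ac_mulb i j x : (0 < i + j)%N -> coef_ac i j (abc_b * x) = 0.
Proof.
move=> ij; elim/abc_ind: x => [x y IHx IHy|k l|k].
- by rewrite mulrDr !coef_acD IHx IHy addr0.
- have [kl|] := boolP (0 < k + l)%N; first by rewrite abc_mul_b_ac ?coef_ac0.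
  rewrite -eqn0Ngt addn_eq0 => /andP[/eqP-> /eqP->].
  by rewrite !expr0 !mulr1 -[abc_b]expr1 !coef_ac_b.
by rewrite -exprS !coef_ac_b.
Qed.

Lemma coef_b_mula k x : coef_b k (abc_a * x) = 0.
Proof.
elim/abc_ind: x => [x y IHx IHy|i j|l].
- by rewrite mulrDr coef_bD IHx IHy addr0.
- by rewrite abc_mul_a coef_b_ac.
by rewrite abc_mul_ab coef_b0.
Qed.

Lemma coef_b_mulc k x : coef_b k (abc_c * x) = 0.
Proof.
elim/abc_ind: x => [x y IHx IHy|i j|l].
- by rewrite mulrDr coef_bD IHx IHy addr0.
- by rewrite abc_mul_c coef_b_ac.
by rewrite abc_mul_cb coef_b0.
Qed.

Lemma coef_b_mulb k x : coef_b k.+1 (abc_b * x) = coef_b k x.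
Proof.
elim/abc_ind: x => [x y IHx IHy|i j|l].
- by rewrite mulrDr !coef_bD IHx IHy.
- have [ij|] := boolP (0 < i + j)%N; first by rewrite abc_mul_b_ac ?coef_b0 ?coef_b_ac.
  rewrite -eqn0Ngt addn_eq0 => /andP[/eqP-> /eqP->].
  by rewrite coef_b_ac !expr0 !mulr1 -[abc_b]expr1 coef_b_b.
by rewrite -exprS !coef_b_b.
Qed.

Lemma abc_degree2_eq0 x : x \in homogeneous 2 -> coef_ac 2 0 x = 0 ->
  coef_ac 1 1 x = 0 -> coef_ac 0 2 x = 0 -> coef_b 1 x = 0 -> x = 0.
Proof.
move=> /homogeneousP x2 e1 e2 e3 e4.
suff : gproj 2 x = coef_ac 2 0 x *: (abc_a ^+ 2 * abc_c ^+ 0) +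
    coef_ac 1 1 x *: (abc_a ^+ 1 * abc_c ^+ 1) +
    coef_ac 0 2 x *: (abc_a ^+ 0 * abc_c ^+ 2) + coef_b 1 x *: abc_b ^+ 2.
  by rewrite x2 e1 e2 e3 e4 !scale0r !addr0.
elim/abc_ind: x {x2 e1 e2 e3 e4} => [x y IHx IHy|i j|k].
- have -> : gproj 2 (x + y) = gproj 2 x + gproj 2 y by exact: raddfD.
  have sD (k l : ('F_2)^o) (v : F2abc) : (k + l) *: v = k *: v + l *: v.
    exact: (scalerDl v (k : 'F_2) (l : 'F_2)).
  rewrite IHx IHy !coef_acD !coef_bD.
  move: (coef_ac _ _ x) (coef_ac _ _ y) (coef_ac _ _ x) (coef_ac _ _ y)
    (coef_ac _ _ x) (coef_ac _ _ y) (coef_b _ x) (coef_b _ y) => p q r s t u v w.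
  by rewrite !sD; char2.
- rewrite abc_gproj_ac !coef_ac_ac coef_b_ac scale0r addr0.
  have pick k l : ((i == k) && (j == l))%:R *: (abc_a ^+ k * abc_c ^+ l) =
      (if (i == k) && (j == l) then abc_a ^+ i * abc_c ^+ j else 0).
    by case: eqP => [->|_]; last rewrite scale0r; case: eqP => [->|_]; rewrite ?scale0r ?scale1r.
  rewrite !pick; move: (abc_a ^+ i * abc_c ^+ j) => y; rewrite eqz_nat {pick}.
  by case: i j => [|[|[|i]]] [|[|[|j]]]; rewrite ?addSn ?addnS //= ?addr0 ?add0r.
rewrite abc_gproj_b !coef_ac_b coef_b_b !scale0r !add0r.
by rewrite eqz_nat eqSS eq_sym; case: eqP => [->|_]; rewrite ?scale0r ?scale1r.
Qed.

End Coefficients.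

Lemma exact_homogeneous_lift (C : dgaType) i (w : C) : exact w ->
  w \in homogeneous (i + 1) -> exists2 u, u \in homogeneous i & diff u = w.
Proof.
move=> [u ->] /homogeneousP wi; exists (gproj i u); first exact: homogeneous_gproj.
by rewrite diff_gproj.
Qed.

Section Degree2.
Variable V : grAlgType.
Implicit Types x y z t : V.

Lemma homogeneous1M y y' : y \in homogeneous 1 -> y' \in homogeneous 1 ->
  y * y' \in homogeneous 2.
Proof. exact: (homogeneousM 1 1). Qed.

Lemma homogeneous2_sum2 x y y' z z' : x \in homogeneous 2 -> y \in homogeneous 1 ->
  y' \in homogeneous 1 -> z \in homogeneous 1 -> z' \in homogeneous 1 ->
  x + (y * y' + z * z') \in homogeneous 2.
Proof. by move=> *; rewrite !homogeneousD ?homogeneous1M. Qed.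

Lemma homogeneous2_sum3 x y y' z z' t t' : x \in homogeneous 2 ->
  y \in homogeneous 1 -> y' \in homogeneous 1 -> z \in homogeneous 1 ->
  z' \in homogeneous 1 -> t \in homogeneous 1 -> t' \in homogeneous 1 ->
  x + (y * y' + z * z' + t * t') \in homogeneous 2.
Proof. by move=> *; rewrite !homogeneousD ?homogeneous1M. Qed.

End Degree2.

Section Represents.
Variables (C : dgaType) (phi : cohomology_iso F2abc C).
Implicit Types (u w : C) (x y : F2abc).

Definition represents w x := diff w = 0 /\ class_of w = phi x.

Lemma representsD w w' x x' :
  represents w x -> represents w' x' -> represents (w + w') (x + x').
Proof.
move=> [dw ew] [dw' ew']; split; first by rewrite raddfD /= dw dw' addr0.
by rewrite class_ofD // ew ew' raddfD.
Qed.

Lemma representsM w w' x x' :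
  represents w x -> represents w' x' -> represents (w * w') (x * x').
Proof.
move=> [dw ew] [dw' ew']; split; first by rewrite leibniz dw dw' mul0r mulr0 addr0.
by rewrite class_ofM // ew ew' (coh_iso_monoid phi).2.
Qed.

(** H is commutative although C is not: this is the source of the null-homotopies of BA and GB, and
    of E. *)
Lemma representsMC w w' x x' :
  represents w x -> represents w' x' -> represents (w' * w) (x * x').
Proof. by rewrite mulrC => wx wx'; apply: representsM. Qed.

Lemma represents_exact w x : represents w x -> exact w <-> x = 0.
Proof.
move=> [dw ew]; have [e1 e2] := class_of_eq0 dw; split=> [/e2 e|e].
  by apply: (bij_inj (coh_iso_bij phi)); rewrite -ew e raddf0.
by apply: e1; rewrite ew e raddf0.
Qed.

Lemma coh_iso_homogeneousE i x : phi x \in homogeneous i -> x \in homogeneous i.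
Proof.
move=> /homogeneousP xi.
have h k v : v \in homogeneous k -> phi v \in homogeneous (k + 0).
  by rewrite addr0; apply: coh_iso_homogeneous.
have := shift_gproj h i x; rewrite addr0 xi => e.
by apply/homogeneousP; apply: (bij_inj (coh_iso_bij phi)); rewrite -e.
Qed.

Lemma represents_homogeneous w i : diff w = 0 -> w \in homogeneous i ->
  exists2 x, x \in homogeneous i & represents w x.
Proof.
move=> dw wi; have [psi psiK phiK] := coh_iso_bij phi.
exists (psi (class_of w)); last by rewrite /represents phiK.
by apply: coh_iso_homogeneousE; rewrite phiK; exact: class_of_homogeneous.
Qed.

Lemma represents_lift x i : x \in homogeneous i ->
  exists2 w, w \in homogeneous i & represents w x.
Proof.
move=> /(coh_iso_homogeneous phi)/class_of_homogeneous_lift [w [dw wi ew]].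
by exists w.
Qed.

End Represents.

(** * The eight brackets, their relations and their indeterminacy *)

Section MasseySystems.
Variables (C : dgaType) (phi : cohomology_iso F2abc C).
Local Notation a := abc_a.
Local Notation b := abc_b.
Local Notation c := abc_c.
Local Notation represents := (represents phi).
Variables A B G : C.

Record massey_system (Eab Eba Ebc Ecb E : C) : Prop := {
  system_A : A \in homogeneous 1; system_B : B \in homogeneous 1;
  system_G : G \in homogeneous 1; system_Eab : Eab \in homogeneous 1;
  system_Eba : Eba \in homogeneous 1; system_Ebc : Ebc \in homogeneous 1;
  system_Ecb : Ecb \in homogeneous 1; system_E : E \in homogeneous 1;
  system_a : represents A a; system_b : represents B b; system_c : represents G c;
  system_dEab : diff Eab = A * B; system_dEba : diff Eba = B * A;
  system_dEbc : diff Ebc = B * G; system_dEcb : diff Ecb = G * B;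
  system_dE : diff E = A * G + G * A
}.

Record massey_classes (Eab Eba Ebc Ecb E : C)
    (aba cbc abc cba bab bcb cab bca : F2abc) : Prop := {
  class_aba : represents (A * Eba + Eab * A) aba;
  class_cbc : represents (G * Ebc + Ecb * G) cbc;
  class_abc : represents (A * Ebc + Eab * G) abc;
  class_cba : represents (G * Eba + Ecb * A) cba;
  class_bab : represents (B * Eab + Eba * B) bab;
  class_bcb : represents (B * Ecb + Ebc * B) bcb;
  class_cab : represents (G * Eab + E * B + A * Ecb) cab;
  class_bca : represents (B * E + Eba * G + Ebc * A) bca;
  class_aba2 : aba \in homogeneous 2; class_cbc2 : cbc \in homogeneous 2;
  class_abc2 : abc \in homogeneous 2; class_cba2 : cba \in homogeneous 2;
  class_bab2 : bab \in homogeneous 2; class_bcb2 : bcb \in homogeneous 2;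
  class_cab2 : cab \in homogeneous 2; class_bca2 : bca \in homogeneous 2
}.

Lemma massey_classes_exist Eab Eba Ebc Ecb E : massey_system Eab Eba Ebc Ecb E ->
  exists aba cbc abc cba bab bcb cab bca,
    massey_classes Eab Eba Ebc Ecb E aba cbc abc cba bab bcb cab bca.
Proof.
case=> hA hB hG h1 h2 h3 h4 h5 [dA _] [dB _] [dG _] d1 d2 d3 d4 d5.
have hM (u v : C) : u \in homogeneous 1 -> v \in homogeneous 1 -> u * v \in homogeneous 2.
  by move=> hu hv; apply: (homogeneousM 1 1).
have rep w : diff w = 0 -> w \in homogeneous 2 -> exists x, x \in homogeneous 2 /\ represents w x.
  by move=> dw w2; have [x x2 wx] := represents_homogeneous phi dw w2; exists x.
have fin1 (u v u' v' : C) : u \in homogeneous 1 -> v \in homogeneous 1 ->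
    u' \in homogeneous 1 -> v' \in homogeneous 1 -> u * v + u' * v' \in homogeneous 2.
  by move=> *; apply: homogeneousD; apply: hM.
have [||aba [? ?]] := rep (A * Eba + Eab * A); [|exact: fin1|].
  by rewrite raddfD /= !leibniz d1 d2 dA !(mul0r, mulr0, add0r, addr0); expand; char2.
have [||cbc [? ?]] := rep (G * Ebc + Ecb * G); [|exact: fin1|].
  by rewrite raddfD /= !leibniz d3 d4 dG !(mul0r, mulr0, add0r, addr0); expand; char2.
have [||abc [? ?]] := rep (A * Ebc + Eab * G); [|exact: fin1|].
  by rewrite raddfD /= !leibniz d1 d3 dG dA !(mul0r, mulr0, add0r, addr0); expand; char2.
have [||cba [? ?]] := rep (G * Eba + Ecb * A); [|exact: fin1|].
  by rewrite raddfD /= !leibniz d4 d2 dG dA !(mul0r, mulr0, add0r, addr0); expand; char2.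
have [||bab [? ?]] := rep (B * Eab + Eba * B); [|exact: fin1|].
  by rewrite raddfD /= !leibniz d1 d2 dB !(mul0r, mulr0, add0r, addr0); expand; char2.
have [||bcb [? ?]] := rep (B * Ecb + Ebc * B); [|exact: fin1|].
  by rewrite raddfD /= !leibniz d3 d4 dB !(mul0r, mulr0, add0r, addr0); expand; char2.
have [||cab [? ?]] := rep (G * Eab + E * B + A * Ecb);
  [|by rewrite !homogeneousD ?hM|].
  by rewrite !raddfD /= !leibniz d1 d4 d5 dA dB dG !(mul0r, mulr0, add0r, addr0); expand; char2.
have [||bca [? ?]] := rep (B * E + Eba * G + Ebc * A);
  [|by rewrite !homogeneousD ?hM|].
  by rewrite !raddfD /= !leibniz d2 d3 d5 dA dB dG !(mul0r, mulr0, add0r, addr0); expand; char2.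
by exists aba, cbc, abc, cba, bab, bcb, cab, bca.
Qed.

(* Each relation comes from a product of two of the null-homotopies, whose
   differential juggles the brackets. *)
Lemma massey_relations Eab Eba Ebc Ecb E aba cbc abc cba bab bcb cab bca :
  massey_system Eab Eba Ebc Ecb E ->
  massey_classes Eab Eba Ebc Ecb E aba cbc abc cba bab bcb cab bca ->
  [/\ a * bab + b * aba = 0, c * bcb + b * cbc = 0, a * bcb + b * abc = 0
     & c * bab + b * cba = 0] /\
  [/\ a * cab + (a * cba + c * aba) = 0, c * cab + (a * cbc + c * abc) = 0,
      a * bca + (c * aba + a * abc) = 0 & b * cab + b * bca = 0].
Proof.
case=> _ _ _ _ _ _ _ _ ra rb rc d1 d2 d3 d4 d5.
have [dA _] := ra; have [dB _] := rb; have [dG _] := rc.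
case=> r1 r2 r3 r4 r5 r6 r7 r8 _ _ _ _ _ _ _ _.
have rel w x u : represents w x -> w = diff u -> x = 0.
  by move=> wx e; apply/(represents_exact wx); exists u.
have dD (u v : C) : diff (u + v) = diff u + diff v by exact: raddfD.
split; split.
(* Adding A Eba B twice to AB Eab + Eab AB gives A (B Eab + Eba B) + (A Eba + Eab A) B; the other
   relations arise in the same way. *)
- apply: (rel _ _ (Eab * Eab) (representsD (representsM ra r5) (representsMC rb r1))).
  by rewrite leibniz d1; expand; char2.
- apply: (rel _ _ (Ecb * Ecb) (representsD (representsM rc r6) (representsMC rb r2))).
  by rewrite leibniz d4; expand; char2.
- apply: (rel _ _ (Eab * Ecb) (representsD (representsM ra r6) (representsMC rb r3))).
  by rewrite leibniz d1 d4; expand; char2.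
- apply: (rel _ _ (Ecb * Eab) (representsD (representsM rc r5) (representsMC rb r4))).
  by rewrite leibniz d1 d4; expand; char2.
- apply: (rel _ _ (E * Eba) (representsD (representsMC ra r7)
    (representsD (representsM ra r4) (representsM rc r1)))).
  by rewrite leibniz d5 d2; expand; char2.
- apply: (rel _ _ (E * Ebc) (representsD (representsMC rc r7)
    (representsD (representsM ra r2) (representsM rc r3)))).
  by rewrite leibniz d5 d3; expand; char2.
- apply: (rel _ _ (Eab * E) (representsD (representsM ra r8)
    (representsD (representsMC rc r1) (representsMC ra r3)))).
  by rewrite leibniz d5 d1; expand; char2.
(* The bracket of cab pairs G Eab with A Ecb, so both products are needed; the terms B E B
   cancel. *)
apply: (rel _ _ (Ebc * Eab + Eba * Ecb)
  (representsD (representsM rb r7) (representsMC rb r8))).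
by rewrite dD !leibniz d1 d2 d3 d4; expand; char2.
Qed.

(** The exponents 0 and 1 are kept explicit so that the lemmas on coefficients apply. *)
Definition abc_linear (k l e : ('F_2)^o) : F2abc :=
  k *: (a ^+ 1 * c ^+ 0) + l *: (a ^+ 0 * c ^+ 1) + e *: b ^+ 1.

Lemma coef_abc_linear k l e :
  [/\ coef_ac 1 0 (abc_linear k l e) = k, coef_ac 0 1 (abc_linear k l e) = l & coef_b 0 (abc_linear k l e) = e].
Proof.
have s1 (t : ('F_2)^o) : t *: (1 : ('F_2)^o) = t by exact: mulr1.
have s0 (t : ('F_2)^o) : t *: (0 : ('F_2)^o) = 0 by exact: mulr0.
rewrite /abc_linear !coef_acD !coef_acZ !coef_ac_ac !coef_ac_b !coef_bD !coef_bZ !coef_b_ac coef_b_b /=.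
by rewrite !s1 !s0 !addr0 !add0r.
Qed.

Lemma abc_linear_homogeneous k l e : abc_linear k l e \in homogeneous 1.
Proof.
have hZ (t : ('F_2)^o) (x : F2abc) : x \in homogeneous 1 -> t *: x \in homogeneous 1.
  by have [->|->] := F2_cases t; rewrite ?scale0r ?scale1r ?homogeneous0.
rewrite /abc_linear !homogeneousD // hZ //; apply/homogeneousP.
- by rewrite abc_gproj_ac.
- by rewrite abc_gproj_ac.
by rewrite abc_gproj_b.
Qed.

(** A null-homotopy may be changed by a cocycle, which moves each bracket within its indeterminacy.
    One correction enters several brackets, so the effects have to be tracked together. *)
Lemma massey_system_adjust Eab Eba Ebc Ecb E (vab vba vbc vcb v : F2abc) :
  massey_system Eab Eba Ebc Ecb E -> vab \in homogeneous 1 -> vba \in homogeneous 1 ->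
  vbc \in homogeneous 1 -> vcb \in homogeneous 1 -> v \in homogeneous 1 ->
  exists Eab' Eba' Ebc' Ecb' E', massey_system Eab' Eba' Ebc' Ecb' E' /\
    forall aba cbc abc cba bab bcb cab bca,
    massey_classes Eab Eba Ebc Ecb E aba cbc abc cba bab bcb cab bca ->
    massey_classes Eab' Eba' Ebc' Ecb' E'
      (aba + (a * vba + a * vab)) (cbc + (c * vbc + c * vcb)) (abc + (a * vbc + c * vab))
      (cba + (c * vba + a * vcb)) (bab + (b * vab + b * vba)) (bcb + (b * vcb + b * vbc))
      (cab + (c * vab + b * v + a * vcb)) (bca + (b * v + c * vba + a * vbc)).
Proof.
move=> S h1 h2 h3 h4 h5.
have [V1 hV1 r1] := represents_lift phi h1; have [V2 hV2 r2] := represents_lift phi h2.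
have [V3 hV3 r3] := represents_lift phi h3; have [V4 hV4 r4] := represents_lift phi h4.
have [V5 hV5 r5] := represents_lift phi h5.
exists (Eab + V1), (Eba + V2), (Ebc + V3), (Ecb + V4), (E + V5); split.
  case: S => *; split; rewrite ?homogeneousD // [LHS]raddfD /=.
  - by case: r1 => -> _; rewrite addr0.
  - by case: r2 => -> _; rewrite addr0.
  - by case: r3 => -> _; rewrite addr0.
  - by case: r4 => -> _; rewrite addr0.
  - by case: r5 => -> _; rewrite addr0.
move=> aba cbc abc cba bab bcb cab bca [q1 q2 q3 q4 q5 q6 q7 q8 k1 k2 k3 k4 k5 k6 k7 k8].
have [_ _ _ _ _ _ _ _ ra rb rc _ _ _ _ _] := S.
have [[ha hb] hc] := (abc_a_homogeneous, abc_b_homogeneous, abc_c_homogeneous).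
split; [.. | exact (homogeneous2_sum2 k1 ha h2 ha h1) | exact (homogeneous2_sum2 k2 hc h3 hc h4)
  | exact (homogeneous2_sum2 k3 ha h3 hc h1) | exact (homogeneous2_sum2 k4 hc h2 ha h4)
  | exact (homogeneous2_sum2 k5 hb h1 hb h2) | exact (homogeneous2_sum2 k6 hb h4 hb h3)
  | exact (homogeneous2_sum3 k7 hc h1 hb h5 ha h4) | exact (homogeneous2_sum3 k8 hb h5 hc h2 ha h3)].
- have := representsD q1 (representsD (representsM ra r2) (representsMC ra r1)).
  congr represents; expand; char2.
- have := representsD q2 (representsD (representsM rc r3) (representsMC rc r4)).
  congr represents; expand; char2.
- have := representsD q3 (representsD (representsM ra r3) (representsMC rc r1)).
  congr represents; expand; char2.
- have := representsD q4 (representsD (representsM rc r2) (representsMC ra r4)).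
  congr represents; expand; char2.
- have := representsD q5 (representsD (representsM rb r1) (representsMC rb r2)).
  congr represents; expand; char2.
- have := representsD q6 (representsD (representsM rb r4) (representsMC rb r3)).
  congr represents; expand; char2.
- have := representsD q7 (representsD (representsD (representsM rc r1) (representsMC rb r5))
    (representsM ra r4)).
  congr represents; expand; char2.
have := representsD q8 (representsD (representsD (representsM rb r5) (representsMC rc r2))
  (representsMC ra r3)).
congr represents; expand; char2.
Qed.

End MasseySystems.

Section NormalizedSystem.
Local Notation a := abc_a.
Local Notation b := abc_b.
Local Notation c := abc_c.

(** Multiples of a and of b have no monomial in common; multiplication by a is injective on the span
    of the a^i c^j, and multiplication by b on that of the powers of b. *)
Lemma mul_ab_eq0 x y : a * x + b * y = 0 ->
  [/\ coef_ac 2 0 x = 0, coef_ac 1 1 x = 0, coef_ac 0 2 x = 0 & coef_b 1 y = 0].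
Proof.
move=> e.
have ac i j : coef_ac i j x = 0.
  have := congr1 (coef_ac i.+1 j) e.
  rewrite coef_acD coef_ac_mula coef_ac_mulb; last by rewrite addSn.
  by rewrite addr0 coef_ac0.
split; [exact: ac | exact: ac | exact: ac |].
by have := congr1 (coef_b 2) e; rewrite coef_bD coef_b_mula coef_b_mulb add0r coef_b0.
Qed.

Lemma mul_cb_eq0 x y : c * x + b * y = 0 ->
  [/\ coef_ac 2 0 x = 0, coef_ac 1 1 x = 0, coef_ac 0 2 x = 0 & coef_b 1 y = 0].
Proof.
move=> e.
have ac i j : coef_ac i j x = 0.
  have := congr1 (coef_ac i j.+1) e.
  rewrite coef_acD coef_ac_mulc coef_ac_mulb; last by rewrite addnS.
  by rewrite addr0 coef_ac0.
split; [exact: ac | exact: ac | exact: ac |].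
by have := congr1 (coef_b 2) e; rewrite coef_bD coef_b_mulc coef_b_mulb add0r coef_b0.
Qed.

Variables (C : dgaType) (phi : cohomology_iso F2abc C).

Record normalized_system (A B G Eab Eba Ebc Ecb E : C) : Prop := {
  normalized_massey : massey_system phi A B G Eab Eba Ebc Ecb E;
  normalized_aba : exact (A * Eba + Eab * A);
  normalized_cbc : exact (G * Ebc + Ecb * G);
  normalized_abc : exact (A * Ebc + Eab * G);
  normalized_cba : exact (G * Eba + Ecb * A);
  normalized_bab : exact (B * Eab + Eba * B);
  normalized_bcb : exact (B * Ecb + Ebc * B);
  normalized_cab : exact (G * Eab + E * B + A * Ecb);
  normalized_bca : exact (B * E + Eba * G + Ebc * A)
}.

Lemma massey_system_exists : exists A B G Eab Eba Ebc Ecb E,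
  massey_system phi A B G Eab Eba Ebc Ecb E.
Proof.
have [[ha hb] hc] := (abc_a_homogeneous, abc_b_homogeneous, abc_c_homogeneous).
have [A hA ra] := represents_lift phi ha; have [B hB rb] := represents_lift phi hb.
have [G hG rc] := represents_lift phi hc.
have lift w x : represents phi w x -> x = 0 -> w \in homogeneous 2 ->
    exists2 u, u \in homogeneous 1 & diff u = w.
  by move=> /represents_exact wx /wx; apply: exact_homogeneous_lift.
have [Eab h1 d1] := lift _ _ (representsM ra rb) abc_ab (homogeneous1M hA hB).
have [Ecb h4 d4] := lift _ _ (representsMC rb rc) abc_bc (homogeneous1M hG hB).
have [Ebc h3 d3] := lift _ _ (representsM rb rc) abc_bc (homogeneous1M hB hG).
have [Eba h2 d2] := lift _ _ (representsMC ra rb) abc_ab (homogeneous1M hB hA).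
have [E h5 d5] := lift _ _ (representsD (representsM ra rc) (representsMC ra rc))
  (F2_addvv (a * c)) (homogeneousD (homogeneous1M hA hG) (homogeneous1M hG hA)).
by exists A, B, G, Eab, Eba, Ebc, Ecb, E.
Qed.

Lemma normalized_system_exists : exists A B G Eab Eba Ebc Ecb E,
  normalized_system A B G Eab Eba Ebc Ecb E.
Proof.
have [A [B [G [Eab [Eba [Ebc [Ecb [E S]]]]]]]] := massey_system_exists.
have [aba [cbc [abc [cba [bab [bcb [cab [bca K]]]]]]]] := massey_classes_exist S.
(* Hence bab and bcb are multiples of b^2, while aba, cbc and abc have no b^2 term. *)
have [[/mul_ab_eq0[p1 p2 p3 p4] /mul_cb_eq0[_ _ _ p5] /mul_ab_eq0[p6 p7 p8 p9] _]
  [r5 r6 _ _]] := massey_relations S K.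
(* In the relations for cab, c^3 can only come from c aba and a^3 only from a cbc; this is why aba
   is divisible by a and cbc by c. *)
have p10 : coef_ac 0 2 aba = 0.
  have := congr1 (coef_ac 0 3) r5.
  by rewrite !coef_acD !coef_ac_mula coef_ac_mulc coef_ac0 !add0r.
have p11 : coef_ac 2 0 cbc = 0.
  have := congr1 (coef_ac 3 0) r6.
  by rewrite !coef_acD !coef_ac_mulc coef_ac_mula coef_ac0 !addr0 !add0r.
(* On the a, c part, where [aba] = a r, [cbc] = c s and [abc] = a p + c q, correct
   by q, q + r, p and p + s; the multiples of b remove the b^2 coefficients. *)
pose vab := abc_linear 0 (coef_ac 0 2 abc) (coef_b 1 bab).
pose vba := abc_linear (coef_ac 2 0 aba) (coef_ac 0 2 abc + coef_ac 1 1 aba) 0.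
pose vbc := abc_linear (coef_ac 2 0 abc) (coef_ac 1 1 abc) 0.
pose vcb := abc_linear (coef_ac 2 0 abc + coef_ac 1 1 cbc) (coef_ac 1 1 abc + coef_ac 0 2 cbc)
  (coef_b 1 bcb).
pose v := abc_linear 0 0 (coef_b 1 cab).
have [Eab' [Eba' [Ebc' [Ecb' [E' [S' KK]]]]]] :=
  massey_system_adjust S (abc_linear_homogeneous _ _ _ : vab \in _) (abc_linear_homogeneous _ _ _ : vba \in _)
   (abc_linear_homogeneous _ _ _ : vbc \in _) (abc_linear_homogeneous _ _ _ : vcb \in _)
   (abc_linear_homogeneous _ _ _ : v \in _).
have K' := KK _ _ _ _ _ _ _ _ K.
have [v1 v2 v3] := coef_abc_linear 0 (coef_ac 0 2 abc) (coef_b 1 bab).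
have [v4 v5 v6] := coef_abc_linear (coef_ac 2 0 aba) (coef_ac 0 2 abc + coef_ac 1 1 aba) 0.
have [v7 v8 v9] := coef_abc_linear (coef_ac 2 0 abc) (coef_ac 1 1 abc) 0.
have [v10 v11 v12] := coef_abc_linear (coef_ac 2 0 abc + coef_ac 1 1 cbc)
  (coef_ac 1 1 abc + coef_ac 0 2 cbc) (coef_b 1 bcb).
have [v13 v14 v15] := coef_abc_linear 0 0 (coef_b 1 cab).
rewrite -/vab in v1 v2 v3; rewrite -/vba in v4 v5 v6; rewrite -/vbc in v7 v8 v9.
rewrite -/vcb in v10 v11 v12; rewrite -/v in v13 v14 v15.
move: vab vba vbc vcb v v1 v2 v3 v4 v5 v6 v7 v8 v9 v10 v11 v12 v13 v14 v15 K' {KK}.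
move=> vab vba vbc vcb v v1 v2 v3 v4 v5 v6 v7 v8 v9 v10 v11 v12 v13 v14 v15 K'.
have bz1 i j x : coef_ac i.+1 j (b * x) = 0 by apply: coef_ac_mulb.
have bz2 j x : coef_ac 0 j.+1 (b * x) = 0 by apply: coef_ac_mulb.
have coefE := (coef_acD, coef_bD, coef_ac_mula, coef_ac_mulc, bz1, bz2, coef_b_mula,
  coef_b_mulc, coef_b_mulb).
have [q1 q2 q3 q4 q5 q6 q7 q8 k1 k2 k3 k4 k5 k6 k7 k8] := K'.
have e1 : aba + (a * vba + a * vab) = 0.
  apply: (abc_degree2_eq0 k1); rewrite !coefE /=.
  - by rewrite v1 v4; char2.
  - by rewrite v2 v5; char2.
  - by rewrite p10; char2.
  - by rewrite p4; char2.
have e2 : cbc + (c * vbc + c * vcb) = 0.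
  apply: (abc_degree2_eq0 k2); rewrite !coefE /=.
  - by rewrite p11; char2.
  - by rewrite v7 v10; char2.
  - by rewrite v8 v11; char2.
  - by rewrite p5; char2.
have e3 : abc + (a * vbc + c * vab) = 0.
  apply: (abc_degree2_eq0 k3); rewrite !coefE /=.
  - by rewrite v7; char2.
  - by rewrite v8 v1; char2.
  - by rewrite v2; char2.
  - by rewrite p9; char2.
have e5 : bab + (b * vab + b * vba) = 0.
  apply: (abc_degree2_eq0 k5); rewrite !coefE /=.
  - by rewrite p1; char2.
  - by rewrite p2; char2.
  - by rewrite p3; char2.
  - by rewrite v3 v6; char2.
have e6 : bcb + (b * vcb + b * vbc) = 0.
  apply: (abc_degree2_eq0 k6); rewrite !coefE /=.
  - by rewrite p6; char2.
  - by rewrite p7; char2.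
  - by rewrite p8; char2.
  - by rewrite v12 v9; char2.
(* The relation c cab = 0 used below does not see b^2, so this coefficient is removed through v. *)
have bcab : coef_b 1 (cab + (c * vab + b * v + a * vcb)) = 0.
  by rewrite !coefE v15; char2.
rewrite e1 e2 e3 e5 e6 in K'.
move: (cab + _) (cba + _) (bca + _) K' bcab {q1 q2 q3 q4 q5 q6 q7 q8 k1 k2 k3 k4 k5 k6 k7 k8}.
move=> cab' cba' bca' K' bcab.
have [q1 q2 q3 q4 q5 q6 q7 q8 _ _ _ k4 _ _ k7 k8] := K'.
have [[_ _ _ s4] [s5 s6 s7 s8]] := massey_relations S' K'.
rewrite ?mulr0 ?add0r ?addr0 in s4 s5 s6 s7 s8.
(* The relations now read c cab = 0, then a cba = b cba = 0 and a bca = b bca = 0; an element of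
   degree 2 killed by both a and b is 0. *)
have e7 : cab' = 0.
  have [|n1 n2 n3 _] := @mul_cb_eq0 cab' 0; first by rewrite mulr0 addr0.
  exact: (abc_degree2_eq0 k7).
rewrite e7 !mulr0 !add0r in s5 s8.
have e4 : cba' = 0.
  have [|n1 n2 n3 n4] := @mul_ab_eq0 cba' cba'; first by rewrite s5 s4 addr0.
  exact: (abc_degree2_eq0 k4).
have e8 : bca' = 0.
  have [|n1 n2 n3 n4] := @mul_ab_eq0 bca' bca'; first by rewrite s7 s8 addr0.
  exact: (abc_degree2_eq0 k8).
exists A, B, G, Eab', Eba', Ebc', Ecb', E'; split=> //.
- exact/(represents_exact q1).
- exact/(represents_exact q2).
- exact/(represents_exact q3).
- exact/(represents_exact q4).
- exact/(represents_exact q5).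
- exact/(represents_exact q6).
- exact/(represents_exact q7).
- exact/(represents_exact q8).
Qed.

End NormalizedSystem.

(** * Assembly *)

Lemma homogeneous_expr (V : grAlgType) (x : V) n :
  x \in homogeneous 1 -> x ^+ n \in homogeneous n.
Proof.
move=> x1; elim: n => [|n IHn]; first exact: homogeneous1.
by rewrite exprS -add1n PoszD; apply: homogeneousM.
Qed.

Lemma homogeneousM_eq (V : grAlgType) i j k (x y : V) :
  x \in homogeneous i -> y \in homogeneous j -> i + j = k -> x * y \in homogeneous k.
Proof. by move=> xi yj <-; apply: homogeneousM. Qed.

Section Products.
Local Notation a := abc_a.
Local Notation b := abc_b.
Local Notation c := abc_c.

Lemma abc_mul_ac_ac i j k l :
  a ^+ i * c ^+ j * (a ^+ k * c ^+ l) = a ^+ (i + k) * c ^+ (j + l).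
Proof. by rewrite mulrACA -!exprD. Qed.

Lemma abc_mul_b_b k l : b ^+ k.+1 * b ^+ l.+1 = b ^+ (k + l).+2.
Proof. by rewrite -exprD addSn addnS. Qed.

Lemma abc_mul_ac_b i j k : (0 < i + j)%N -> a ^+ i * c ^+ j * b ^+ k.+1 = 0.
Proof.
by move=> ij; rewrite exprS mulrA [_ * b]mulrC abc_mul_b_ac // mul0r.
Qed.

Lemma abc_mul_bk_ac i j k : (0 < i + j)%N -> b ^+ k.+1 * (a ^+ i * c ^+ j) = 0.
Proof. by move=> ij; rewrite mulrC abc_mul_ac_b. Qed.

End Products.

Section Assembly.
Variables (C : dgaType) (phi : cohomology_iso F2abc C).
Variables A B G Eab Eba Ebc Ecb E : C.
Hypothesis N : normalized_system phi A B G Eab Eba Ebc Ecb E.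
Local Notation a := abc_a.
Local Notation b := abc_b.
Local Notation c := abc_c.
Local Notation comm1 := (comm1 A E).
Local Notation comm := (comm A G E).
Local Notation null_l := (null_l A G Eab Ecb).
Local Notation null_r := (null_r A G Eba Ebc).

Let S := normalized_massey N.
Let dA : diff A = 0. Proof. by case: (system_a S). Qed.
Let dB : diff B = 0. Proof. by case: (system_b S). Qed.
Let dG : diff G = 0. Proof. by case: (system_c S). Qed.
Let dE : diff E = A * G + G * A. Proof. exact: system_dE S. Qed.
Let hA n : A ^+ n \in homogeneous n. Proof. exact/homogeneous_expr/(system_A S). Qed.
Let hB n : B ^+ n \in homogeneous n. Proof. exact/homogeneous_expr/(system_B S). Qed.
Let hG n : G ^+ n \in homogeneous n. Proof. exact/homogeneous_expr/(system_G S). Qed.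

Definition lift1 : F2abc -> C :=
  abc_extend (fun i j => A ^+ i * G ^+ j) (fun k => B ^+ k.+1).

(** The homotopy that brings a product of two basis monomials to normal form: c^j is moved past a^k,
    or the monomial in a and c is killed against the adjacent b while the remaining powers of B are
    kept. Powers of B multiply strictly, hence the value 0. *)
Definition lift2 (x y : F2abc) : C :=
  abc_extend
    (fun i j => abc_extend (fun k l => A ^+ i * comm j k * G ^+ l)
                           (fun k => null_l i j * B ^+ k) y)
    (fun k => abc_extend (fun i j => B ^+ k * null_r i j) (fun=> 0) y) x.

Lemma lift1D x y : lift1 (x + y) = lift1 x + lift1 y.
Proof. exact: abc_extendD. Qed.

Lemma lift1_ac i j : lift1 (a ^+ i * c ^+ j) = A ^+ i * G ^+ j.
Proof. exact: abc_extend_ac. Qed.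

Lemma lift1_b k : lift1 (b ^+ k.+1) = B ^+ k.+1.
Proof. exact: abc_extend_b. Qed.

Lemma lift2Dl x y z : lift2 (x + y) z = lift2 x z + lift2 y z.
Proof. exact: abc_extendD. Qed.

Lemma lift2Dr x y z : lift2 x (y + z) = lift2 x y + lift2 x z.
Proof.
elim/abc_ind: x => [x x' IHx IHx'|i j|k].
- rewrite !lift2Dl IHx IHx'; char2.
- by rewrite /lift2 !abc_extend_ac abc_extendD.
by rewrite /lift2 !abc_extend_b abc_extendD.
Qed.

Lemma lift2_ac_ac i j k l :
  lift2 (a ^+ i * c ^+ j) (a ^+ k * c ^+ l) = A ^+ i * comm j k * G ^+ l.
Proof. by rewrite /lift2 !abc_extend_ac. Qed.

Lemma lift2_ac_b i j k : lift2 (a ^+ i * c ^+ j) (b ^+ k.+1) = null_l i j * B ^+ k.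
Proof. by rewrite /lift2 abc_extend_ac abc_extend_b. Qed.

Lemma lift2_b_ac i j k : lift2 (b ^+ k.+1) (a ^+ i * c ^+ j) = B ^+ k * null_r i j.
Proof. by rewrite /lift2 abc_extend_b abc_extend_ac. Qed.

Lemma lift2_b_b k l : lift2 (b ^+ k.+1) (b ^+ l.+1) = 0.
Proof. by rewrite /lift2 !abc_extend_b. Qed.

Lemma lift2_0l x : lift2 0 x = 0.
Proof. by rewrite -(F2_addvv (1 : F2abc)) lift2Dl F2_addvv. Qed.

Lemma lift2_0r x : lift2 x 0 = 0.
Proof. by rewrite -(F2_addvv (1 : F2abc)) lift2Dr F2_addvv. Qed.

Lemma lift1_0 : lift1 0 = 0.
Proof. by rewrite -(F2_addvv (1 : F2abc)) lift1D F2_addvv. Qed.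

Lemma abc_1E : 1 = a ^+ 0 * c ^+ 0 :> F2abc.
Proof. by rewrite !expr0 mulr1. Qed.

Lemma lift1_1 : lift1 1 = 1.
Proof. by rewrite abc_1E lift1_ac !expr0 mulr1. Qed.

Lemma lift2_1l x : lift2 1 x = 0.
Proof.
elim/abc_ind: x => [x y IHx IHy|i j|k].
- by rewrite lift2Dr IHx IHy addr0.
- by rewrite abc_1E lift2_ac_ac /= mulr0 mul0r.
by rewrite abc_1E lift2_ac_b /= mul0r.
Qed.

Lemma lift2_1r x : lift2 x 1 = 0.
Proof.
elim/abc_ind: x => [x y IHx IHy|i j|k].
- by rewrite lift2Dl IHx IHy addr0.
- by rewrite abc_1E lift2_ac_ac comm0r mulr0 mul0r.
by rewrite abc_1E lift2_b_ac /= mulr0.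
Qed.

Lemma lift1_represents x : represents phi (lift1 x) x.
Proof.
have rX w y n : represents phi w y -> represents phi (w ^+ n) (y ^+ n).
  move=> wy; elim: n => [|n IHn]; last by rewrite !exprS; apply: representsM.
  by split; [exact: dga_diff1 | rewrite class_of1 (coh_iso_monoid phi).1].
elim/abc_ind: x => [x y IHx IHy|i j|k].
- by rewrite lift1D; apply: representsD.
- by rewrite lift1_ac; apply: representsM; apply: rX; [exact: system_a S | exact: system_c S].
by rewrite lift1_b; apply: rX; exact: system_b S.
Qed.

Lemma lift1_homogeneous i x : x \in homogeneous i -> lift1 x \in homogeneous i.
Proof.
move=> /homogeneousP <-; elim/abc_ind: x => [x y IHx IHy|j k|k].
- have -> : gproj i (x + y) = gproj i x + gproj i y by exact: raddfD.
  by rewrite lift1D; exact: (homogeneousD IHx IHy).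
- rewrite abc_gproj_ac; case: eqP => [->|_]; last by rewrite lift1_0 homogeneous0.
  by rewrite lift1_ac PoszD; exact: (homogeneousM _ _ _ _ (hA j) (hG k)).
rewrite abc_gproj_b; case: eqP => [->|_]; last by rewrite lift1_0 homogeneous0.
by rewrite lift1_b; exact: hB.
Qed.

Lemma comm_homogeneous j k : comm j k \in homogeneous ((j + k)%N%:Z - 1).
Proof.
have h1 : comm1 k \in homogeneous k.
  elim: k => [|k IHk] /=; first exact: homogeneous0.
  apply: homogeneousD.
    by apply: (homogeneousM_eq IHk (system_A S)); rewrite -addn1 PoszD.
  by apply: (homogeneousM_eq (hA k) (system_E S)); rewrite -addn1 PoszD.
elim: j => [|j IHj] /=; first exact: homogeneous0.
apply: homogeneousD.
  apply: (homogeneousM_eq (system_G S) IHj); rewrite addSn -addn1 PoszD; ring.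
by apply: (homogeneousM_eq h1 (hG j)); rewrite addSn -addn1 !PoszD; ring.
Qed.

Lemma null_l_homogeneous i j : null_l i j \in homogeneous (i + j)%N.
Proof.
case: j => [|j] /=; last first.
  apply: (homogeneousM_eq (homogeneousM _ _ _ _ (hA i) (hG j)) (system_Ecb S)).
  by rewrite addnS -addn1 !PoszD.
case: i => [|i]; first exact: homogeneous0.
by apply: (homogeneousM_eq (hA i) (system_Eab S)); rewrite addn0 -addn1 PoszD.
Qed.

Lemma null_r_homogeneous i j : null_r i j \in homogeneous (i + j)%N.
Proof.
case: i => [|i] /=; last first.
  apply: (homogeneousM_eq (homogeneousM _ _ _ _ (system_Eba S) (hA i)) (hG j)).
  by rewrite addSn -addn1 !PoszD; ring.
case: j => [|j]; first exact: homogeneous0.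
by apply: (homogeneousM_eq (system_Ebc S) (hG j)); rewrite add0n -addn1 PoszD addrC.
Qed.

Lemma lift2_homogeneous i j x y : x \in homogeneous i -> y \in homogeneous j ->
  lift2 x y \in homogeneous (i + j - 1).
Proof.
have gD d u v : gproj d (u + v : F2abc) = gproj d u + gproj d v by exact: raddfD.
move=> /homogeneousP <- /homogeneousP <-.
elim/abc_ind: x => [x x' IHx IHx'|k l|k].
- by rewrite gD lift2Dl; exact: (homogeneousD IHx IHx').
- rewrite abc_gproj_ac; case: eqP => [->|_]; last by rewrite lift2_0l homogeneous0.
  elim/abc_ind: y => [y y' IHy IHy'|m n|m].
  + by rewrite gD lift2Dr; exact: (homogeneousD IHy IHy').
  + rewrite abc_gproj_ac; case: eqP => [->|_]; last by rewrite lift2_0r homogeneous0.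
    rewrite lift2_ac_ac.
    apply: (homogeneousM_eq (homogeneousM _ _ _ _ (hA k) (comm_homogeneous l m)) (hG n)).
    by rewrite !PoszD; ring.
  rewrite abc_gproj_b; case: eqP => [->|_]; last by rewrite lift2_0r homogeneous0.
  rewrite lift2_ac_b; apply: (homogeneousM_eq (null_l_homogeneous k l) (hB m)).
  by rewrite -addn1 !PoszD; ring.
rewrite abc_gproj_b; case: eqP => [->|_]; last by rewrite lift2_0l homogeneous0.
elim/abc_ind: y => [y y' IHy IHy'|m n|m].
- by rewrite gD lift2Dr; exact: (homogeneousD IHy IHy').
- rewrite abc_gproj_ac; case: eqP => [->|_]; last by rewrite lift2_0r homogeneous0.
  rewrite lift2_b_ac; apply: (homogeneousM_eq (hB k) (null_r_homogeneous m n)).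
  by rewrite -addn1 !PoszD; ring.
rewrite abc_gproj_b; case: eqP => [->|_]; last by rewrite lift2_0r homogeneous0.
by rewrite lift2_b_b homogeneous0.
Qed.

(** The null-homotopies require a monomial of positive degree; the monomial 1 is treated apart, by
    the unitality of [lift1] and [lift2]. *)
Lemma ac_unit i j : (0 < i + j)%N \/ a ^+ i * c ^+ j = 1.
Proof.
have [ij|] := boolP (0 < i + j)%N; first by left.
by rewrite -eqn0Ngt addn_eq0 => /andP[/eqP-> /eqP->]; right; rewrite !expr0 mulr1.
Qed.

Lemma diff_lift2 x y : diff (lift2 x y) = lift1 x * lift1 y + lift1 (x * y).
Proof.
have dAn n := diff_expr n dA; have dGn n := diff_expr n dG; have dBn n := diff_expr n dB.
have dD (u v : C) : diff (u + v) = diff u + diff v by exact: raddfD.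
have d0 : diff (0 : C) = 0 by exact: raddf0.
have dnl i j := diff_null_l dA dG (system_dEab S) (system_dEcb S) (i := i) (j := j).
have dnr i j := diff_null_r dA dG (system_dEba S) (system_dEbc S) (i := i) (j := j).
elim/abc_ind: x => [x x' IHx IHx'|i j|k].
- by rewrite lift2Dl dD IHx IHx' mulrDl !lift1D; expand; char2.
- have [ij|->] := ac_unit i j; last first.
    by rewrite lift2_1l d0 lift1_1 !mul1r F2_addvv.
  elim/abc_ind: y => [y y' IHy IHy'|k l|k].
  + by rewrite lift2Dr dD IHy IHy' mulrDr !lift1D; expand; char2.
  + rewrite lift2_ac_ac abc_mul_ac_ac !lift1_ac !leibniz dAn dGn (diff_comm dA dG dE) !exprD.
    by rewrite mul0r mulr0 add0r addr0; expand; char2.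
  rewrite lift2_ac_b abc_mul_ac_b // lift1_0 lift1_ac lift1_b leibniz dBn dnl //.
  by rewrite mulr0 !addr0 exprS; expand; char2.
elim/abc_ind: y => [y y' IHy IHy'|i j|l].
- by rewrite lift2Dr dD IHy IHy' mulrDr !lift1D; expand; char2.
- have [ij|->] := ac_unit i j; last first.
    by rewrite lift2_1r d0 lift1_1 !mulr1 F2_addvv.
  rewrite lift2_b_ac abc_mul_bk_ac // lift1_0 lift1_ac lift1_b leibniz dBn dnr //.
  by rewrite mul0r addr0 add0r exprSr; expand; char2.
by rewrite lift2_b_b abc_mul_b_b !lift1_b d0 -exprD addSn addnS F2_addvv.
Qed.

Definition lift_defect x y z := lift1 x * lift2 y z + lift2 x y * lift1 z +
  lift2 (x * y) z + lift2 x (y * z).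

Lemma lift_defectD1 x x' y z :
  lift_defect (x + x') y z = lift_defect x y z + lift_defect x' y z.
Proof. by rewrite /lift_defect mulrDl !(lift1D, lift2Dl); expand; char2. Qed.

Lemma lift_defectD2 x y y' z :
  lift_defect x (y + y') z = lift_defect x y z + lift_defect x y' z.
Proof.
by rewrite /lift_defect mulrDl mulrDr !(lift1D, lift2Dl, lift2Dr); expand; char2.
Qed.

Lemma lift_defectD3 x y z z' :
  lift_defect x y (z + z') = lift_defect x y z + lift_defect x y z'.
Proof. by rewrite /lift_defect mulrDr !(lift1D, lift2Dr); expand; char2. Qed.

Lemma lift_defect1 y z :
  [/\ lift_defect 1 y z = 0, lift_defect y 1 z = 0 & lift_defect y z 1 = 0].
Proof.
split; rewrite /lift_defect !(mul1r, mulr1, lift1_1, lift2_1l, lift2_1r, mul0r, mulr0).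
- by char2.
- by char2.
by char2.
Qed.

(** Triples with two adjacent powers of b have defect 0, because powers of B are carried along
    unchanged; the other types reduce to the explicit homotopies. *)
Lemma exact_lift_defect x y z : exact (lift_defect x y z).
Proof.
have dBn n := diff_expr n dB.
have [dEab dEba] := (system_dEab S, system_dEba S).
have [dEbc dEcb] := (system_dEbc S, system_dEcb S).
have e0 w : w = 0 -> exact w by move=> ->; exact: exact0.
elim/abc_ind: x => [x x' IHx IHx'|i j|p].
- by rewrite lift_defectD1; exact: exactD IHx IHx'.
- have [ij|->] := ac_unit i j; last by apply: e0; case: (lift_defect1 y z).
  elim/abc_ind: y => [y y' IHy IHy'|k l|q].
  + by rewrite lift_defectD2; exact: exactD IHy IHy'.
  + have [kl|->] := ac_unit k l; last first.
      by apply: e0; case: (lift_defect1 (a ^+ i * c ^+ j) z).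
    elim/abc_ind: z => [z z' IHz IHz'|m n|r].
    * by rewrite lift_defectD3; exact: exactD IHz IHz'.
    * rewrite /lift_defect !abc_mul_ac_ac !lift2_ac_ac !lift1_ac.
      exact: (exact_ac_ac_ac dA dG dE).
    have := exactMr (dBn r) (exact_ac_ac_b dA dG dEab dEcb dE (normalized_cab N) i j kl).
    congr exact; rewrite /lift_defect abc_mul_ac_ac (abc_mul_ac_b r kl) lift2_0r.
    by rewrite !lift2_ac_b lift2_ac_ac lift1_ac lift1_b [B ^+ r.+1]exprS; expand; char2.
  elim/abc_ind: z => [z z' IHz IHz'|m n|r].
  + by rewrite lift_defectD3; exact: exactD IHz IHz'.
  + have [mn|->] := ac_unit m n; last first.
      by apply: e0; case: (lift_defect1 (a ^+ i * c ^+ j) (b ^+ q.+1)).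
    rewrite /lift_defect (abc_mul_ac_b q ij) (abc_mul_bk_ac q mn) lift2_0l lift2_0r !addr0.
    rewrite lift2_b_ac lift2_ac_b !lift1_ac.
    (* If the middle factor is b itself, the two null-homotopies compete for the same letter and a
       bracket appears; in a higher power they use different letters. *)
    case: q => [|q].
      rewrite expr0 mul1r mulr1.
      exact: (exact_ac_b_ac dA dG (normalized_aba N) (normalized_cbc N)
        (normalized_abc N) (normalized_cba N) ij mn).
    have := exact_diff (null_l i j * B ^+ q * null_r m n); congr exact.
    rewrite !leibniz dBn (diff_null_l dA dG dEab dEcb ij) (diff_null_r dA dG dEba dEbc mn).
    rewrite mulr0 addr0 exprS; expand; rewrite -[null_l i j * B * _]mulrA -exprS exprSr.
    by expand; char2.
  apply: e0; rewrite /lift_defect (abc_mul_ac_b q ij) lift2_0l abc_mul_b_b.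
  rewrite lift2_b_b !lift2_ac_b lift1_b -mulrA -exprD addnS mulr0; char2.
elim/abc_ind: y => [y y' IHy IHy'|k l|q].
- by rewrite lift_defectD2; exact: exactD IHy IHy'.
- have [kl|->] := ac_unit k l; last by apply: e0; case: (lift_defect1 (b ^+ p.+1) z).
  elim/abc_ind: z => [z z' IHz IHz'|m n|r].
  + by rewrite lift_defectD3; exact: exactD IHz IHz'.
  + have := exactMl (dBn p) (exact_b_ac_ac dA dG dEba dEbc dE (normalized_bca N) m n kl).
    congr exact; rewrite /lift_defect abc_mul_ac_ac (abc_mul_bk_ac p kl) lift2_0l.
    by rewrite !lift2_b_ac lift2_ac_ac lift1_ac lift1_b [B ^+ p.+1]exprSr; expand; char2.
  have := exactMr (dBn r) (exactMl (dBn p)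
    (exact_b_ac_b dA dG dEab dEba dEbc dEcb (normalized_bab N) (normalized_bcb N) kl)).
  congr exact; rewrite /lift_defect (abc_mul_bk_ac p kl) (abc_mul_ac_b r kl) lift2_0l lift2_0r.
  rewrite lift2_b_ac lift2_ac_b !lift1_b [B ^+ p.+1]exprSr [B ^+ r.+1]exprS.
  by expand; char2.
elim/abc_ind: z => [z z' IHz IHz'|m n|r].
- by rewrite lift_defectD3; exact: exactD IHz IHz'.
- have [mn|->] := ac_unit m n; last first.
    by apply: e0; case: (lift_defect1 (b ^+ p.+1) (b ^+ q.+1)).
  apply: e0; rewrite /lift_defect (abc_mul_bk_ac q mn) lift2_0r abc_mul_b_b.
  rewrite lift2_b_b !lift2_b_ac lift1_b mulrA -exprD addSn mul0r; char2.
apply: e0; rewrite /lift_defect !abc_mul_b_b !lift2_b_b mul0r mulr0; char2.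
Qed.

End Assembly.

Lemma A3_data_exists (C : dgaType) (phi : cohomology_iso F2abc C) :
  exists f1 f2, @A3_data C f1 f2.
Proof.
have [A [B [G [Eab [Eba [Ebc [Ecb [E N]]]]]]]] := normalized_system_exists phi.
have [psi psiK phiK] := coh_iso_bij phi.
have phi_inj := can_inj psiK.
have psiD x y : psi (x + y) = psi x + psi y.
  by apply: phi_inj; rewrite raddfD /= !phiK.
have psiM x y : psi (x * y) = psi x * psi y.
  by apply: phi_inj; rewrite (coh_iso_monoid phi).2 !phiK.
have psi_homogeneous i x : x \in homogeneous i -> psi x \in homogeneous i.
  by move=> xi; apply: (coh_iso_homogeneousE (phi := phi)); rewrite phiK.
exists (lift1 A B G \o psi), (fun x y => lift2 A B G Eab Eba Ebc Ecb E (psi x) (psi y)).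
split=> /=.
- by move=> x y; rewrite psiD lift1D.
- by move=> x; case: (lift1_represents N (psi x)).
- by move=> x; case: (lift1_represents N (psi x)) => _ ->.
- by move=> i x /psi_homogeneous; exact: (lift1_homogeneous N).
- by move=> x y z; rewrite psiD lift2Dl.
- by move=> x y z; rewrite psiD lift2Dr.
- by move=> i j x y /psi_homogeneous xi /psi_homogeneous yj; exact: (lift2_homogeneous N xi yj).
- by move=> x y; rewrite psiM; exact: (diff_lift2 N).
by move=> x y z; rewrite !psiM; exact: (exact_lift_defect N).
Qed.

Theorem theorem1p1 (C : dgaType) (phi : cohomology_iso F2abc C) :
  A3_formal C /\
  (forall x y z : cohomology C,
     (x * y = 0)%R -> (y * z = 0)%R -> massey_vanishes x y z) /\
  massey_vanishes (phi abc_a) (phi abc_b) (phi abc_c).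
Proof.
have [f1 [f2 D]] := A3_data_exists phi.
split; first exact: (A3_formal_criterion D).
split=> [x y z|]; first exact: (massey_vanishes_of_data D).
by apply: (massey_vanishes_of_data D);
  rewrite -(coh_iso_monoid phi).2 ?abc_ab ?abc_bc raddf0.
Qed.
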